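(* Let $n \ge 1$, let $C$ be a symmetric convex body in $\mathbb{R}^n$ and let $Q$ be an $n$-dimensional cube in $\mathbb{R}^n$. Then there is an affine image $\widetilde{C}$ of $C$ satisfying $$|\widetilde{C}| = |Q| \quad\text{and}\quad |\partial \widetilde{C}| \le |\partial Q|.$$
   Context: A convex body in $\mathbb{R}^n$ is a compact convex set with non-empty interior; it is symmetric if $C = -C$. An affine image of $C$ is the image of $C$ under an invertible affine map $\mathbb{R}^n \to \mathbb{R}^n$. For a convex body $K$, $|K|$ denotes its $n$-dimensional volume and $|\partial K|$ denotes its surface area, i.e. $|\partial K| = \lim_{\varepsilon \to 0^+} \frac{|K + \varepsilon B_2^n| - |K|}{\varepsilon}$, where $B_2^n$ is the Euclidean unit ball of $\mathbb{R}^n$. *)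

(* Defs.v *)
From HB Require Import structures.
From mathcomp Require Import all_boot all_order all_algebra.
From mathcomp Require Import all_classical all_reals all_analysis.

Set Implicit Arguments.
Unset Strict Implicit.
Unset Printing Implicit Defensive.

Import Order.TTheory GRing.Theory Num.Theory.
Import numFieldNormedType.Exports.

Local Open Scope classical_set_scope.
Local Open Scope ring_scope.

(* Points of R^n are row vectors ['rV[R]_n].  The library's norm on ['rV[R]_n]
   is the sup norm: it is used here only for the topology ([compact],
   [interior]), and Euclidean notions are spelled out. *)

Section VolumeAndSurface.
Context {R : realType}.
Implicit Types n : nat.

(* n-fold product of the Lebesgue measure of R.  As for [m1 \x m2] itself, the
   value is meaningful only on measurable (for instance compact) sets. *)
Fixpoint lebesgue_tuple n : set (n.-tuple R) -> \bar R :=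
  match n with
  | 0 => fun A => \d_[tuple] A
  | m.+1 => fun A =>
      (lebesgue_measure \x @lebesgue_tuple m)%E
        [set p : R * m.-tuple R | A [tuple of p.1 :: p.2]]
  end.

Definition volume n (A : set 'rV[R]_n) : \bar R :=
  lebesgue_tuple [set t : n.-tuple R | A (\row_i tnth t i)].

Definition euclidean_norm n (x : 'rV[R]_n) : R :=
  Num.sqrt (\sum_i x 0 i ^+ 2).

Definition euclidean_unit_ball n : set 'rV[R]_n :=
  [set x | euclidean_norm x <= 1].

(* K + e B_2^n *)
Definition parallel_body n (K : set 'rV[R]_n) (e : R) : set 'rV[R]_n :=
  [set x + e *: u | x in K & u in @euclidean_unit_ball n].

(* The limit exists for every convex body; [lim] is a default value when there is
   no limit. *)
Definition surface_area n (K : set 'rV[R]_n) : \bar R :=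
  lim (((volume (parallel_body K e) - volume K) * (e^-1)%:E)%E @[e --> 0^'+]).

End VolumeAndSurface.

Section Bodies.
Context {R : realType} {n : nat}.
Implicit Types C D Q : set 'rV[R]_n.

Definition convex_body C : Prop :=
  [/\ compact C, convex_set C & interior C !=set0].

Definition symmetric_body C : Prop := C = [set - x | x in C].

Definition affine_image C D : Prop :=
  exists2 A : 'M[R]_n, A \in unitmx &
  exists b : 'rV[R]_n, D = [set x *m A + b | x in C].

(* A cube with edges of length s parallel to the rows of the orthogonal matrix
   U, and with vertex c; it need not be parallel to the axes. *)
Definition cube Q : Prop :=
  exists c : 'rV[R]_n, exists2 s : R, 0 < s &
  exists2 U : 'M[R]_n, U *m U^T = 1%:M &
  Q = [set c + s *: (t *m U) | t in [set t : 'rV[R]_n | forall i, 0 <= t 0 i <= 1]].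

End Bodies.

(* Main.v *)
From HB Require Import structures.
Require Import Defs.
From mathcomp Require Import all_boot all_order all_algebra.
From mathcomp Require Import all_classical all_reals all_analysis.
From mathcomp Require Import measurable_realfun.
From mathcomp Require Import lra ring complex.

Set Implicit Arguments.
Unset Strict Implicit.
Unset Printing Implicit Defensive.

Import Order.TTheory GRing.Theory Num.Theory.
Import numFieldNormedType.Exports.

Local Open Scope classical_set_scope.
Local Open Scope ring_scope.

(* Proof idea.  Among all matrices M = sum_i p_i a_i^T a_i, with p a probability
   vector and a_i in the polar of C, and their limits, take one of maximal
   determinant.  Maximality gives a M^-1 a^T <= n on the polar, so that
   { x | n x M x^T <= 1 } lies in C: if N N^T = n M, the position D = C N contains
   the unit ball B.

   Moreover |D| <= 2^n.  By density it is enough to bound the intersection of the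
   slabs |<x, u_i>| <= 1 when sum_i c_i u_i^T u_i = I and sum_i c_i = n.  As in
   Barthe's proof of the Brascamp-Lieb inequality, let tau transport the uniform
   probability of [-1, 1] to (almost) the Gaussian one; the image of the slabs
   under x |-> sum_i c_i |u_i| tau(<x, u_i>) u_i has Gaussian measure at most 1,
   and the Jacobian is controlled by
   det (sum_i c_i t_i u_i^T u_i) >= prod_i t_i ^ (c_i |u_i|^2).

   Finally let C' be the dilate l D of D with |C'| = |Q| = s^n, so that l >= s/2.
   Since l B is contained in C', C' + e B is contained in (1 + e/l) C', and the
   surface area of C' is at most n s^n / l <= 2 n s^(n-1), that of Q. *)

(** * Volume *)

(** John's decomposition at contact points is bypassed. The maximizer is only a limit of finite
    designs, so the volume estimate is proved for each design and reaches the maximizer as an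
    inequality between determinants, through |D|^2 = n^n det M |C|^2. The price is that the u_i are
    not unit vectors. Since sum_i c_i |u_i|^2 = n = sum_i c_i, the inequality w ln w >= w - 1 gives
    sum_i c_i |u_i|^2 ln |u_i| >= 0, and the factor |u_i| in the transport map exploits this.

    The target Gaussian is truncated to [-r, r], which makes tau Lipschitz; r grows only at the end.
    The Jacobian enters through coverings: the slabs are cut into the parts sent into the cells of a
    fine grid, and a second order Taylor bound encloses each part in the linear preimage of a
    slightly larger box. The density e^(-x^2) stays unnormalized, as its total mass cancels.

    For C' an upper bound on the difference quotient of the volume suffices; for the cube its limit
    is computed exactly, from matching bounds on both sides. *)

Section TupleMeasure.
Context {R : realType}.

Definition cons_pair m (p : R * m.-tuple R) : m.+1.-tuple R :=
  [tuple of p.1 :: p.2].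

Lemma measurable_cons_pair m : measurable_fun setT (@cons_pair m).
Proof. exact: measurable_cons. Qed.

Definition uncons m (t : m.+1.-tuple R) : R * m.-tuple R :=
  (thead t, [tuple of behead t]).

Lemma measurable_uncons m : measurable_fun setT (@uncons m).
Proof.
apply: measurable_fun_pair; first exact: measurable_tnth.
exact: measurable_behead.
Qed.

Lemma cons_pairK m : cancel (@cons_pair m) (@uncons m).
Proof.
move=> [x t]; rewrite /cons_pair /uncons theadE; congr pair.
by apply: val_inj.
Qed.

Section ConsMeasure.
Variables (m : nat) (mu : {sigma_finite_measure set (m.-tuple R) -> \bar R}).

(** Convertible to the successor case of [lebesgue_tuple], so that a sigma-finite measure structure
    can be carried along the recursion; products and Tonelli both rely on it. *)
Definition cons_measure : set (m.+1.-tuple R) -> \bar R :=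
  pushforward (lebesgue_measure \x mu)%E (@cons_pair m).

Let cons_measure0 : cons_measure set0 = 0%E.
Proof. by rewrite /cons_measure /pushforward preimage_set0 measure0. Qed.

Let cons_measure_ge0 A : (0 <= cons_measure A)%E.
Proof. by rewrite /cons_measure /pushforward measure_ge0. Qed.

Let cons_measure_sigma_additive : semi_sigma_additive cons_measure.
Proof.
have mpre A : measurable A -> measurable (@cons_pair m @^-1` A).
  by move=> mA; rewrite -[X in measurable X]setTI; exact: measurable_cons_pair.
move=> F mF tF mUF; rewrite /cons_measure /pushforward preimage_bigcup.
apply: measure_semi_sigma_additive => [k||]; first exact: mpre.
  apply/trivIsetP => i j _ _ ij; rewrite -preimage_setI.
  by move/trivIsetP : tF => /(_ _ _ _ _ ij) ->//; rewrite preimage_set0.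
by rewrite -preimage_bigcup; exact: mpre.
Qed.

HB.instance Definition _ := isMeasure.Build _ _ _ cons_measure
  cons_measure0 cons_measure_ge0 cons_measure_sigma_additive.

Let cons_measure_sigma_finite : sigma_finite setT cons_measure.
Proof.
have /sigma_finiteP[F [TF ndF Foo]] : sigma_finite setT (@lebesgue_measure R).
  exact: sigma_finiteT.
have /sigma_finiteP[G [TG ndG Goo]] := sigma_finiteT mu.
exists (fun k => @uncons m @^-1` (F k `*` G k)).
  rewrite -preimage_bigcup; apply/seteqP; split=> // t _.
  have [i _ Fi] : (\bigcup_i F i) (uncons t).1 by rewrite -TF.
  have [j _ Gj] : (\bigcup_i G i) (uncons t).2 by rewrite -TG.
  exists (maxn i j) => //; split.
    by move/subsetPset : (ndF _ _ (leq_maxl i j)); exact.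
  by move/subsetPset : (ndG _ _ (leq_maxr i j)); exact.
move=> k; have [mF Fk] := Foo k; have [mG Gk] := Goo k; split.
  rewrite -[X in measurable X]setTI; apply: measurable_uncons => //.
  exact: measurableX.
rewrite /cons_measure /pushforward -comp_preimage.
rewrite (_ : _ \o _ = id) ?preimage_id; last first.
  by apply/funext => p /=; rewrite cons_pairK.
by rewrite product_measure1E// lte_mul_pinfty// ge0_fin_numE.
Qed.

HB.instance Definition _ := Measure_isSigmaFinite.Build _ _ _ cons_measure
  cons_measure_sigma_finite.

End ConsMeasure.

Lemma lebesgue_tuple_measure n :
  exists mu : {sigma_finite_measure set (n.-tuple R) -> \bar R},
    (mu : set _ -> \bar R) = @lebesgue_tuple R n.
Proof.
elim: n => [|m [mu muE]]; first by exists (@dirac _ (0.-tuple R) [tuple] R).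
by exists (cons_measure mu); rewrite /= -muE.
Qed.

End TupleMeasure.

Section Affine1.
Context {R : realType}.
Local Notation mu := (@lebesgue_measure R).

Definition affine1 (a b : R) : measurableTypeR R -> measurableTypeR R :=
  fun x => a * x + b.

Lemma measurable_affine1 (a b : R) : measurable_fun setT (affine1 a b).
Proof. by apply: measurable_funD => //; exact: mulrl_measurable. Qed.

HB.instance Definition _ (a b : R) :=
  isMeasurableFun.Build _ _ _ _ (affine1 a b) (measurable_affine1 a b).

(** A multiple of the image measure agrees with [mu] on half-open intervals, hence on all measurable
    sets. For a < 0 the preimage of such an interval is open at the other end, which does not change
    its length. *)
Lemma lebesgue_measure_affine (a b : R) (A : set R) : a != 0 -> measurable A ->
  mu (affine1 a b @^-1` A) = (`|a|^-1%:E * mu A)%E.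
Proof.
move=> a0 mA; have na0 : 0 < `|a| by rewrite normr_gt0.
suff -> : mu A = (`|a|%:E * mu (affine1 a b @^-1` A))%E.
  by rewrite muleA -EFinM mulVf ?gt_eqF// mul1e.
pose m : {measure set (measurableTypeR R) -> \bar R} :=
  mscale (NngNum (ltW na0)) (pushforward mu (affine1 a b)).
rewrite -[RHS]/(m (measurable_affine1 a b) A).
apply: lebesgue_measure_unique => //= _ [[c d]] _ <-.
rewrite /m /mscale/= /pushforward.
case: (ltgtP a 0) a0 => // a0 _.
- rewrite (_ : _ @^-1` _ = `[(d - b) / a, (c - b) / a[%classic); last first.
    apply/seteqP; split=> x /=; rewrite !in_itv/= /affine1 => /andP[h1 h2].
      by rewrite ler_ndivrMr// ltr_ndivlMr// lerBrDr ltrBlDr mulrC h1 h2.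
    rewrite ler_ndivrMr// lerBrDr in h1; rewrite ltr_ndivlMr// ltrBlDr in h2.
    by rewrite mulrC h2 h1.
  rewrite !lebesgue_measure_itv/= !lte_fin ltr_ndivrMr// divfK ?lt_eqF//.
  rewrite ltrD2r; case: ifPn => [cd|]; last by rewrite mule0.
  rewrite -EFinB -EFinM ltr0_norm//; congr EFin.
  by field; rewrite lt_eqF.
- rewrite (_ : _ @^-1` _ = `](c - b) / a, (d - b) / a]%classic); last first.
    apply/seteqP; split=> x /=; rewrite !in_itv/= /affine1 => /andP[h1 h2].
      by rewrite ltr_pdivrMr// ler_pdivlMr// ltrBlDr lerBrDr mulrC h1 h2.
    rewrite ltr_pdivrMr// ltrBlDr in h1; rewrite ler_pdivlMr// lerBrDr in h2.
    by rewrite mulrC h2 h1.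
  rewrite !lebesgue_measure_itv/= !lte_fin ltr_pdivlMr// divfK ?gt_eqF//.
  rewrite ltrD2r; case: ifPn => [cd|]; last by rewrite mule0.
  rewrite -EFinB -EFinM gtr0_norm//; congr EFin.
  by field; rewrite gt_eqF.
Qed.

Lemma integral_affine1 (a b : R) (f : R -> \bar R) : a != 0 ->
  measurable_fun setT f -> (forall x, (0 <= f x)%E) ->
  (\int[mu]_x f (a * x + b)%R = `|a|^-1%:E * \int[mu]_x f x)%E.
Proof.
move=> a0 mf f0; have na0 : 0 < `|a| by rewrite normr_gt0.
have na1 : 0 <= `|a|^-1 by rewrite invr_ge0.
rewrite -[LHS](@ge0_integral_pushforward _ _ _ _ _ _ (measurable_affine1 a b) mu setT f)//.
rewrite -(@ge0_integral_mscale _ _ _ mu setT _ (NngNum na1))//.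
apply: eq_measure_integral => A mA _; rewrite /pushforward/=.
exact: lebesgue_measure_affine.
Qed.

End Affine1.

Section VolumeMeasure.
Context {R : realType}.
Local Notation mu := (@lebesgue_measure R).

Definition vrow n (t : n.-tuple R) : 'rV[R]_n := \row_i tnth t i.

(** Measurability is pulled back to tuples, whose product sigma-algebra is the one on which
    [lebesgue_tuple] is a measure. *)
Definition vmeasurable n (A : set 'rV[R]_n) : Prop := measurable (@vrow n @^-1` A).

Definition tuple_measure n : {sigma_finite_measure set (n.-tuple R) -> \bar R} :=
  projT1 (cid (lebesgue_tuple_measure n)).

Lemma volumeE n (A : set 'rV[R]_n) : volume A = tuple_measure n (@vrow n @^-1` A).
Proof. by rewrite /tuple_measure; case: cid => /= m ->. Qed.

Lemma vrow_cons m (x : R) (t : m.-tuple R) :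
  vrow [tuple of x :: t] = row_mx x%:M (vrow t) :> 'rV[R]_(1 + m).
Proof.
apply/rowP => i; rewrite !mxE; case: splitP => j ij.
  have -> : i = ord0 by apply/val_inj; rewrite /= ij (ord1 j).
  by rewrite mxE (ord1 j) eqxx mulr1n.
have -> : i = lift ord0 j by apply/val_inj; rewrite /= ij.
by rewrite mxE tnthS.
Qed.

Lemma vmeasurable_preimage n m (f : 'rV[R]_n -> 'rV[R]_m) (A : set 'rV[R]_m) :
  (forall j, measurable_fun setT (fun t : n.-tuple R => f (vrow t) 0 j)) ->
  vmeasurable A -> vmeasurable (f @^-1` A).
Proof.
move=> mf mA.
pose g (t : n.-tuple R) : m.-tuple R := [tuple f (vrow t) 0 j | j < m].
have mg : measurable_fun setT g.
  apply/measurable_fun_tnthP => j; rewrite (_ : _ \o _ = fun t => f (vrow t) 0 j)//.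
  by apply/funext => t /=; rewrite tnth_mktuple.
rewrite /vmeasurable (_ : _ @^-1` _ = g @^-1` (@vrow m @^-1` A)).
  by rewrite -[X in measurable X]setTI; exact: mg.
apply/seteqP; split => t /=; suff -> : vrow (g t) = f (vrow t) by [].
  by apply/rowP => i; rewrite mxE tnth_mktuple.
by apply/rowP => i; rewrite mxE tnth_mktuple.
Qed.

Lemma measurable_coord n i : measurable_fun setT (fun t : n.-tuple R => (vrow t) 0 i).
Proof.
rewrite (_ : (fun _ => _) = (@tnth _ R ^~ i)); first exact: measurable_tnth.
by apply/funext => t; rewrite mxE.
Qed.

Lemma vmeasurable_affine n m (M : 'M[R]_(n, m)) b (X : set 'rV[R]_m) :
  vmeasurable X -> vmeasurable [set v | X (v *m M + b)].
Proof.
move=> mX; apply: (vmeasurable_preimage (f := fun v => v *m M + b)) => // j.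
rewrite (_ : (fun _ => _) = (fun t : n.-tuple R => \sum_k (vrow t) 0 k * M k j + b 0 j)).
  apply: measurable_funD => //; apply: measurable_sum => k.
  by apply: measurable_funM => //; exact: measurable_coord.
by apply/funext => t; rewrite !mxE.
Qed.

Lemma volume_consE m (X : set 'rV[R]_(1 + m)) :
  (volume X = \int[mu]_x volume [set y | X (row_mx x%:M y)])%E.
Proof.
rewrite {1}/volume/= /product_measure1; apply: eq_integral => x _ /=.
congr lebesgue_tuple; apply/seteqP; split => t /=.
  by rewrite /xsection/= inE/= -vrow_cons.
by rewrite /xsection/= inE/= -vrow_cons.
Qed.

Lemma vmeasurable_cons m (X : set 'rV[R]_(1 + m)) : vmeasurable X ->
  measurable [set p : R * m.-tuple R | X (row_mx p.1%:M (vrow p.2))].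
Proof.
move=> mX; rewrite (_ : [set _ | _] = @cons_pair R m @^-1` (@vrow (1 + m) @^-1` X)).
  by rewrite -[X in measurable X]setTI; exact: measurable_cons_pair.
by apply/seteqP; split => -[x t] /=; rewrite vrow_cons.
Qed.

Lemma vmeasurable_section m (X : set 'rV[R]_(1 + m)) x : vmeasurable X ->
  vmeasurable [set y | X (row_mx x%:M y)].
Proof.
move=> /vmeasurable_cons /(measurable_xsection x).
by rewrite /vmeasurable (_ : xsection _ _ = @vrow m @^-1` [set y | X (row_mx x%:M y)])//;
  apply/seteqP; split => t /=; rewrite /xsection/= inE.
Qed.

Lemma measurable_volume_section m (X : set 'rV[R]_(1 + m)) : vmeasurable X ->
  measurable_fun setT (fun x : R => volume [set y | X (row_mx x%:M y)]).
Proof.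
move=> /vmeasurable_cons /(measurable_fun_xsection (tuple_measure m)).
apply: eq_measurable_fun => x _ /=; rewrite volumeE; congr (tuple_measure _ _).
by apply/seteqP; split => t /=; rewrite /xsection/= inE.
Qed.

(** Tonelli, by uniqueness of the product measure. Integrating over the first coordinate innermost
    is what a shear of that coordinate requires, in [scales_lunit]. *)
Lemma volume_consE2 m (X : set 'rV[R]_(1 + m)) : vmeasurable X ->
  (volume X = \int[tuple_measure m]_t mu [set x | X (row_mx x%:M (vrow t))])%E.
Proof.
move=> mX; rewrite volumeE.
have mX' := vmeasurable_cons mX.
transitivity ((mu \x tuple_measure m)%E [set p : R * m.-tuple R | X (row_mx p.1%:M (vrow p.2))]).
  rewrite -volumeE volume_consE; apply: eq_integral => x _ /=.
  rewrite volumeE; congr (tuple_measure _ _).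
  by apply/seteqP; split => t /=; rewrite /xsection/= inE.
rewrite (@product_measure_unique _ _ _ _ _ mu (tuple_measure m) (mu \x^ tuple_measure m)%E)//.
  rewrite /= /product_measure2; apply: eq_integral => t _ /=.
  by congr lebesgue_measure; apply/seteqP; split => x /=; rewrite /ysection/= inE.
by move=> A B mA mB; exact: product_measure2E.
Qed.

End VolumeMeasure.

(** * Volume under affine maps *)

Section VolumeAffine.
Context {R : realType}.
Local Notation mu := (@lebesgue_measure R).

Lemma volume_ge0 n (X : set 'rV[R]_n) : (0 <= volume X)%E.
Proof. by rewrite volumeE measure_ge0. Qed.

Lemma mul_row_scalar_block m (x a : R) (y b : 'rV[R]_m) (D : 'M[R]_m) :
  row_mx x%:M y *m block_mx a%:M b 0 D = row_mx (x * a)%:M (y *m D + x *: b).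
Proof.
by rewrite mul_row_block mulmx0 addr0 -scalar_mxM mul_scalar_mx [X in row_mx _ X]addrC.
Qed.

Lemma volume_translate n (b : 'rV[R]_n) (X : set 'rV[R]_n) : vmeasurable X ->
  volume [set v | X (v + b)] = volume X.
Proof.
elim: n => [|m IH] in b X *.
  move=> _; congr volume; apply/seteqP; split => v /=; by rewrite [v + b]thinmx0 [v]thinmx0.
rewrite -[b]/(b : 'rV[R]_(1 + m)) => mX; rewrite !(volume_consE (m := m)).
pose g (x : R) := volume [set y | X (row_mx x%:M y : 'rV[R]_(1 + m))].
transitivity (\int[mu]_x g (1 * x + b 0 0)%R)%E.
  apply: eq_integral => x _; rewrite /g.
  rewrite -[RHS](IH (@rsubmx _ 1 1 m b)); last exact: vmeasurable_section.
  congr volume; apply: eq_set => y /=; congr (X _).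
  rewrite -[X in _ + X](@hsubmxK _ 1 1 m) (@add_row_mx _ 1 1 m) mul1r.
  apply: (f_equal2 (@row_mx R 1 1 m)) => //.
  by apply/matrixP => i j; rewrite !ord1 !mxE eqxx !mulr1n; congr (_ + b _ _); apply/val_inj.
rewrite (integral_affine1 (b 0 0) (f := g) (oner_neq0 R)); last 2 first.
- exact: (measurable_volume_section (m := m)).
- by move=> x; exact: volume_ge0.
by rewrite normr1 invr1 mul1e.
Qed.

(** Preimages are used because they stay measurable and compose; hence the inverse of the
    determinant. *)
Definition scales n (A : 'M[R]_n) := forall X : set 'rV[R]_n, vmeasurable X ->
  volume [set v | X (v *m A)] = (`|\det A|^-1%:E * volume X)%E.

Lemma vmeasurable_mulmx n m (M : 'M[R]_(n, m)) (X : set 'rV[R]_m) :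
  vmeasurable X -> vmeasurable [set v | X (v *m M)].
Proof.
move=> /(vmeasurable_affine M 0).
by under eq_set do rewrite addr0.
Qed.

Lemma scales1 n : scales (1%:M : 'M[R]_n).
Proof.
move=> X mX; rewrite det1 normr1 invr1 mul1e; congr volume.
by apply: eq_set => v; rewrite mulmx1.
Qed.

Lemma scales_mul n (A B : 'M[R]_n) : scales A -> scales B -> scales (A *m B).
Proof.
move=> sA sB X mX.
rewrite det_mulmx normrM invfM EFinM -muleA -sB// -sA; last exact: vmeasurable_mulmx.
by congr volume; apply: eq_set => v /=; rewrite mulmxA.
Qed.

Lemma vmeasurable_translate n (b : 'rV[R]_n) (X : set 'rV[R]_n) :
  vmeasurable X -> vmeasurable [set v | X (v + b)].
Proof.
move=> /(vmeasurable_affine 1%:M b).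
by under eq_set do rewrite mulmx1.
Qed.

(** With the first coordinate x frozen, the map acts on the others as [D] followed by the
    translation by [x *: b]. Integration over x reduces the claim to [D] and to a dilation of the
    line. *)
Lemma scales_ublock m (a : R) (b : 'rV[R]_m) (D : 'M[R]_m) : a != 0 ->
  scales D -> scales (block_mx a%:M b 0 D : 'M[R]_(1 + m)).
Proof.
move=> a0 sD X mX; rewrite !volume_consE.
have gmeas := measurable_volume_section mX.
pose g (x : R) := volume [set y | X (row_mx x%:M y : 'rV[R]_(1 + m))].
transitivity (\int[mu]_x ((`|\det D|^-1)%:E * g (a * x + 0)%R))%E.
  apply: eq_integral => x _; rewrite /g.
  have mS := vmeasurable_section (a * x + 0) mX.
  rewrite -(volume_translate (x *: b) mS) -sD; last exact: vmeasurable_translate.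
  by congr volume; apply: eq_set => y /=; rewrite mul_row_scalar_block addr0 mulrC.
rewrite ge0_integralZl//; last 2 first.
- by apply: measurableT_comp => //; apply: measurable_affine1.
- by move=> x _; exact: volume_ge0.
rewrite (integral_affine1 0 (f := g) a0)//; last by move=> x; exact: volume_ge0.
by rewrite muleA -EFinM det_ublock det_scalar1 normrM invfM mulrC.
Qed.

Lemma scales_lunit m (c : 'cV[R]_m) :
  scales (block_mx 1%:M 0 c 1%:M : 'M[R]_(1 + m)).
Proof.
move=> X mX; rewrite det_lblock !det1 mulr1 normr1 invr1 mul1e.
rewrite !volume_consE2//; last exact: vmeasurable_mulmx.
apply: eq_integral => t _.
pose h := [set x | X (row_mx x%:M (vrow t))].
have mh : measurable h.
  move: (vmeasurable_cons mX) => /(measurable_ysection t).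
  by congr measurable; apply/seteqP; split => x /=; rewrite /ysection/= inE.
have := lebesgue_measure_affine ((vrow t *m c) 0 0) (oner_neq0 R) mh.
rewrite normr1 invr1 mul1e => <-.
congr lebesgue_measure; apply: eq_set => x; rewrite /h /= /affine1.
rewrite mul_row_block !mulmx1 mulmx0 add0r; congr (X (row_mx _ _)).
by rewrite mul1r raddfD/= [vrow t *m c]mx11_scalar !mxE eqxx mulr1n.
Qed.

(* One step of block elimination: A is the product of an upper unitriangular
   matrix (making the pivot nonzero), a lower one, and a block triangular one,
   to which the induction hypothesis applies. *)
Lemma unitmx_scales n (A : 'M[R]_n) : A \in unitmx -> scales A.
Proof.
elim: n => [|m IH] in A *.
  by move=> _; have -> : A = 1%:M; [apply/matrixP => -[]|exact: scales1].
rewrite -[A]/(A : 'M[R]_(1 + m)) -[A](@submxK _ 1 m 1 m).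
set a := ulsubmx _; set b := ursubmx _; set c := dlsubmx _; set D := drsubmx _.
clearbody a b c D => {A} uA.
have [w w0] : exists w : 'rV_m, (a + w *m c) 0 0 != 0.
  have [a0|a0] := eqVneq (a 0 0) 0; last by exists 0; rewrite mul0mx addr0.
  have [c0|/eqP c0] := eqVneq c 0.
    move: uA; rewrite unitmxE c0 (@det_ublock _ 1 m) (mx11_scalar a) a0 det_scalar1 mul0r.
    by rewrite unitr0.
  have [i ci] : exists i, c i 0 != 0.
    apply: contrapT => H; apply: c0; apply/matrixP => i j; rewrite ord1 mxE.
    by apply: contrapT => /eqP ci; apply: H; exists i.
  by exists (delta_mx 0 i); rewrite mxE a0 add0r -rowE mxE.
pose a' := (a + w *m c) 0 0; pose b' := b + w *m D; pose D' := D - a'^-1 *: (c *m b').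
have AE : block_mx a b c D = block_mx 1%:M (- w) 0 1%:M *m
    (block_mx 1%:M 0 (a'^-1 *: c) 1%:M *m block_mx a'%:M b' 0 D') :> 'M[R]_(1 + m).
  rewrite !mulmx_block ?mul1mx ?mul0mx ?mulmx0 ?addr0 ?add0r.
  have -> : a'^-1 *: c *m a'%:M = c by rewrite -scalemxAl mul_mx_scalar scalerA mulVf// scale1r.
  have -> : a'^-1 *: c *m b' + D' = D by rewrite /D' -scalemxAl addrC subrK.
  congr block_mx; first by rewrite -mx11_scalar mulNmx addrK.
  by rewrite mulNmx addrK.
have uD' : D' \in unitmx.
  move: uA; rewrite AE !unitmxE !det_mulmx !(@det_ublock _ 1 m) (@det_lblock _ 1 m).
  by rewrite !det1 !mul1r det_scalar1 unitrM => /andP[].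
rewrite AE; apply: scales_mul.
  by rewrite -[X in block_mx X]/(1%:M); apply: scales_ublock; [exact: oner_neq0|exact: scales1].
apply: scales_mul; first exact: scales_lunit.
by apply: scales_ublock => //; exact: IH.
Qed.

Lemma volume_affine n (A : 'M[R]_n) b (X : set 'rV[R]_n) :
  A \in unitmx -> vmeasurable X ->
  volume [set v | X (v *m A + b)] = (`|\det A|^-1%:E * volume X)%E.
Proof.
move=> uA mX; rewrite -(volume_translate b mX).
by rewrite -(unitmx_scales uA)//; exact: vmeasurable_translate.
Qed.

End VolumeAffine.

Section VolumeMeasurable.
Context {R : realType}.
Local Notation mu := (@lebesgue_measure R).

Lemma le_volume n (X Y : set 'rV[R]_n) : vmeasurable X -> vmeasurable Y ->
  X `<=` Y -> (volume X <= volume Y)%E.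
Proof.
move=> mX mY XY; rewrite !volumeE; apply: le_measure; rewrite ?inE//.
exact: preimage_subset.
Qed.

Lemma volume_cover n (K : finType) (X : set 'rV[R]_n) (Y : K -> set 'rV[R]_n) :
  vmeasurable X -> (forall k, vmeasurable (Y k)) ->
  X `<=` \bigcup_k Y k -> (volume X <= \sum_k volume (Y k))%E.
Proof.
move=> mX mY XY; rewrite volumeE.
under eq_bigr do rewrite volumeE; rewrite -big_enum.
rewrite (fsbig_seq _ _ (enum_uniq K)); apply: content_sub_fsum => //; first by move=> k _; exact: mY.
by move=> t /= /XY [k _ Yk]; exists k; rewrite //= mem_enum.
Qed.

Lemma vmeasurable_bigcup n (K : countType) (P : set K) (Y : K -> set 'rV[R]_n) :
  (forall k, vmeasurable (Y k)) -> vmeasurable (\bigcup_(k in P) Y k).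
Proof.
move=> mY; rewrite bigcup_mkcond /vmeasurable preimage_bigcup.
apply: countable_bigcupT_measurable => [|k]; first exact: countableP.
by case: ifP => _; [exact: mY|rewrite preimage_set0].
Qed.

Lemma vmeasurableC n (X : set 'rV[R]_n) : vmeasurable X -> vmeasurable (~` X).
Proof. by move=> mX; rewrite /vmeasurable preimage_setC; exact: measurableC. Qed.

Definition box n (l u : 'rV[R]_n) : set 'rV[R]_n :=
  [set v | forall i, l 0 i <= v 0 i <= u 0 i].

Lemma vmeasurable_prod n (J : 'I_n -> set R) : (forall i, measurable (J i)) ->
  vmeasurable [set v : 'rV[R]_n | forall i, J i (v 0 i)].
Proof.
move=> mJ; rewrite (_ : mkset _ = ~` \bigcup_i [set v : 'rV[R]_n | ~ J i (v 0 i)]); last first.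
  apply/seteqP; split => v /= h.
    by move=> [i _]; apply; exact: h.
  by move=> i; apply: contrapT => ?; apply: h; exists i.
apply: vmeasurableC; apply: vmeasurable_bigcup => i.
rewrite /vmeasurable (_ : _ @^-1` _ = ~` ((fun t : n.-tuple R => (vrow t) 0 i) @^-1` J i)).
  apply: measurableC; rewrite -[X in measurable X]setTI.
  exact: (@measurable_coord R n i).
by apply/seteqP; split.
Qed.

Lemma vmeasurable_box n (l u : 'rV[R]_n) : vmeasurable (box l u).
Proof.
have := @vmeasurable_prod n (fun i => `[l 0 i, u 0 i]%classic).
rewrite (_ : mkset _ = box l u); first by apply => i; exact: measurable_itv.
by apply/seteqP; split => v /= h i; have := h i; rewrite in_itv.
Qed.

(** An open set is the union of the closed cells it contains among those with corners in Z^n / (k +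
    1), k natural: a countable family. Balls of the sup norm are cubes, so a cell of mesh below the
    radius fits in them. *)
Lemma vmeasurable_open n (U : set 'rV[R]_n) : open U -> vmeasurable U.
Proof.
move=> oU.
pose cell (kz : nat * 'rV[int]_n) : set 'rV[R]_n :=
  [set v | forall i, `[((kz.2 0 i)%:~R / kz.1.+1%:R) , ((kz.2 0 i + 1)%:~R / kz.1.+1%:R)]%classic (v 0 i)].
rewrite (_ : U = \bigcup_(kz in [set kz | cell kz `<=` U]) cell kz).
  apply: vmeasurable_bigcup => kz.
  exact: (vmeasurable_prod (fun i => measurable_itv
    `[((kz.2 0 i)%:~R / kz.1.+1%:R), ((kz.2 0 i + 1)%:~R / kz.1.+1%:R)])).
apply/seteqP; split => [v Uv|v [kz /= cU cv]]; last exact: cU.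
have /nbhs_ballP[e /= e0 eU] : nbhs v U by move: oU; rewrite openE => /(_ _ Uv).
pose k := Num.truncn e^-1.
have k0 : 0 < k.+1%:R :> R by rewrite ltr0n.
have ke : k.+1%:R^-1 < e.
  rewrite invf_plt ?posrE//.
  exact: real_truncnS_gt (num_real _).
pose z : 'rV[int]_n := \row_i Num.floor (v 0 i * k.+1%:R).
have zv i : (z 0 i)%:~R / k.+1%:R <= v 0 i < (z 0 i + 1)%:~R / k.+1%:R.
  rewrite ler_pdivrMr// ltr_pdivlMr// mxE.
  by rewrite real_floor_le ?num_real// real_floorD1_gt// num_real.
exists (k, z) => /=; last first.
  by move=> i; rewrite /= ?in_itv/=; have /andP[-> /ltW ->] := zv i.
move=> w wz; apply: eU; split => // i j; rewrite (ord1 i).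
have := wz j; rewrite /= ?in_itv/= => /andP[h1 h2]; have /andP[h3 h4] := zv j.
rewrite /ball/=; apply: le_lt_trans ke.
have E : (z 0 j + 1)%:~R / k.+1%:R = (z 0 j)%:~R / k.+1%:R + k.+1%:R^-1 :> R.
  by rewrite intrD mulrDl mul1r.
rewrite E in h2 h4; move: h1 h2 h3 h4; set q := _ / _; set s := _^-1.
by move=> h1 h2 h3 h4; rewrite ler_norml; apply/andP; split; lra.
Qed.

Lemma vmeasurable_compact n (X : set 'rV[R]_n) : compact X -> vmeasurable X.
Proof.
move=> /(compact_closed (@norm_hausdorff _ _)) cX.
by rewrite -[X]setCK; apply: vmeasurableC; apply: vmeasurable_open; exact: closed_openC.
Qed.

Lemma volume_box n (l u : 'rV[R]_n) : (forall i, l 0 i <= u 0 i) ->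
  volume (box l u) = (\prod_i (u 0 i - l 0 i))%:E.
Proof.
elim: n => [|m IH] in l u *.
  move=> _; rewrite /volume/= diracE big_ord0 mem_set//=.
  by move=> [].
move=> lu; rewrite (volume_consE (m := m)).
pose l' : 'rV[R]_m := \row_i l 0 (lift ord0 i).
pose u' : 'rV[R]_m := \row_i u 0 (lift ord0 i).
have [l'u' lu0] : (forall i, l' 0 i <= u' 0 i) /\ l 0 0 <= u 0 0.
  by split => // i; rewrite !mxE.
have E (x : R) (y : 'rV[R]_m) : box l u (row_mx x%:M y : 'rV[R]_(1 + m)) <->
    l 0 0 <= x <= u 0 0 /\ box l' u' y.
  have e0 : ord0 = lshift m (0 : 'I_1) :> 'I_(1 + m) by apply/val_inj.
  have eS j : lift ord0 j = rshift 1 j :> 'I_(1 + m) by apply/val_inj.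
  have x0 : (row_mx x%:M y : 'rV[R]_(1 + m)) 0 ord0 = x.
    by rewrite e0 row_mxEl mxE eqxx.
  have xS j : (row_mx x%:M y : 'rV[R]_(1 + m)) 0 (lift ord0 j) = y 0 j.
    by rewrite eS row_mxEr.
  split=> [h|[h1 h2] i].
    split; first by have := h ord0; rewrite x0.
    by move=> i; have := h (lift ord0 i); rewrite xS !mxE.
  case: (unliftP ord0 i) => [j|] -> {i}; last by rewrite x0.
  by have := h2 j; rewrite xS !mxE.
transitivity (\int[mu]_x ((\1_(`[l 0 0, u 0 0]%classic) x)%:E * volume (box l' u')))%E.
  apply: eq_integral => x _; rewrite indicE; case: (boolP (x \in _)).
    rewrite inE/= in_itv/= => xl; rewrite mul1e; congr volume.
    by apply/seteqP; split => y /= => [/E[]|h]; last exact/E.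
  rewrite notin_setE/= in_itv/= => xl; rewrite mul0e.
  rewrite (_ : mkset _ = set0); first by rewrite volumeE preimage_set0 measure0.
  by apply/seteqP; split => y //= /E[].
rewrite ge0_integralZr//; last 2 first.
- exact/measurable_EFinP/measurable_indic.
- exact: volume_ge0.
rewrite integral_indic// setIT [X in (X * _)%E]lebesgue_measure_itv/= lte_fin IH// big_ord_recl.
rewrite EFinM; congr (_ * _)%E; last by congr EFin; apply: eq_bigr => i _; rewrite !mxE.
by move: lu0; rewrite le_eqVlt => /predU1P[->|->]; rewrite ?ltxx ?subrr ?EFinB.
Qed.

End VolumeMeasurable.

(** * Linear algebra *)

Section GramDeterminant.
Local Open Scope sesquilinear_scope.
Context {R : realType}.

(** With u_i the rows of [U], this is sum_i w_i u_i^T u_i. Tight frames, derivatives of transport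
    maps and designs all take this form. *)
Definition gram m n (U : 'M[R]_(m, n)) (w : 'rV[R]_m) : 'M[R]_n :=
  U^T *m diag_mx w *m U.

(** Weighted arithmetic-geometric inequality: average over i the tangent line bound t_i >= e^L (1 +
    ln t_i - L), where L is the mean of the ln t_i. *)
Lemma expR_jensen (I : finType) (w t : I -> R) :
  (forall i, 0 <= w i) -> \sum_i w i = 1 -> (forall i, 0 < t i) ->
  expR (\sum_i w i * ln (t i)) <= \sum_i w i * t i.
Proof.
move=> w0 w1 t0; set L := \sum_i _.
suff : \sum_i w i * (expR L * (1 + (ln (t i) - L))) <= \sum_i w i * t i.
  apply: le_trans; rewrite le_eqVlt; apply/orP; left; apply/eqP.
  under eq_bigr do rewrite mulrCA mulrDr mulr1 mulrBr.
  by rewrite -mulr_sumr !big_split/= sumrN -mulr_suml w1 mul1r -/L subrr addr0 mulr1.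
apply: ler_sum => i _; apply: ler_wpM2l => //.
rewrite [leRHS](_ : t i = expR L * expR (ln (t i) - L)).
  by rewrite ler_pM2l ?expR_gt0// expR_ge1Dx.
by rewrite -expRD addrC subrK lnK ?posrE.
Qed.

(* Jensen in an eigenbasis P of the Gram matrix: the eigenvalues are the averages
   sum_i c_i |(P u_i)_j|^2 t_i, whose weights sum to 1 over i, and to c_i |u_i|^2
   over j. *)
Lemma det_gram_ge m n (U : 'M[R]_(m, n)) (c t : 'I_m -> R) :
  (forall i, 0 <= c i) -> (forall i, 0 < t i) ->
  gram U (\row_i c i) = 1%:M ->
  expR (\sum_i c i * (\sum_k U i k ^+ 2) * ln (t i)) <=
  \det (gram U (\row_i (c i * t i))).
Proof.
move=> c0 t0 gram1.
(* Diagonalization takes place over the complex numbers. [P] need not be real, but only the squared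
   moduli [om] of its products with the u_i enter, and these are. *)
pose C : numClosedFieldType := complex R.
pose iota : {rmorphism R -> C} := real_complex R.
pose Uc : 'M[C]_(m, n) := map_mx iota U.
have conjU : Uc ^t* = map_mx iota U^T.
  by apply/matrixP => i j; rewrite !mxE; exact: conjc_real.
pose D (w : 'rV[R]_m) : 'M[C]_n := map_mx iota (gram U w).
have DE w : D w = Uc ^t* *m diag_mx (map_mx iota w) *m Uc.
  by rewrite /D /gram !map_mxM conjU -map_diag_mx.
have [P uP] : exists2 P : 'M[C]_n, P \is unitarymx &
    exists d, P *m D (\row_i (c i * t i)) *m P^t* = diag_mx d.
  have : D (\row_i (c i * t i)) \is normalmx.
    apply/hermitian_normalmx/is_hermitianmxP; rewrite expr0 scale1r.
    have gT : (gram U (\row_i (c i * t i)))^T = gram U (\row_i (c i * t i)).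
      by rewrite /gram !trmx_mul trmxK tr_diag_mx mulmxA.
    rewrite /D map_trmx gT -map_mx_comp; apply: eq_map_mx => x /=.
    by apply/esym; exact: conjc_real.
  move=> /orthomx_spectralP ->; exists (spectralmx (D (\row_i (c i * t i)))).
    exact: spectral_unitarymx.
  exists (spectral_diag (D (\row_i (c i * t i)))).
  set P := spectralmx _; set d := spectral_diag _.
  have uP : P \is unitarymx by exact: spectral_unitarymx.
  rewrite invmx_unitary// !mulmxA (unitarymxP uP) mul1mx -mulmxA.
  by rewrite (unitarymxP uP) mulmx1.
move=> [d dE].
have PP : P *m P^t* = 1%:M by apply/unitarymxP.
have PP' : P^t* *m P = 1%:M by apply: mulmx1C.
pose Z := P *m Uc^t*.
have Zt : Z^t* = Uc *m P^t* by rewrite /Z trmx_mul map_mxM !trmxCK.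
have ZE w j : (P *m D w *m P^t*) j j = \sum_i iota (w 0 i) * `|Z j i| ^+ 2.
  rewrite DE !mulmxA -/Z -mulmxA.
  rewrite -Zt.
  rewrite mxE; apply: eq_bigr => i _.
  by rewrite mul_mx_diag !mxE normCK; ring.
pose om j i := complex.Re (`|Z j i| ^+ 2).
have omE j i : iota (om j i) = `|Z j i| ^+ 2.
  by apply: RRe_real; rewrite realX// normr_real.
have om0 j i : 0 <= om j i.
  by rewrite -ler0c -/(iota (om j i)) omE exprn_ge0.
have om1 j : \sum_i c i * om j i = 1.
  apply: (@complexI R); rewrite -/(iota _) rmorph_sum.
  transitivity ((P *m D (\row_i c i) *m P^t*) j j).
    by rewrite ZE; apply: eq_bigr => i _; rewrite rmorphM mxE omE.
  by rewrite /D gram1 map_mx1 mulmx1 PP mxE eqxx.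
have omU i : \sum_j om j i = \sum_k U i k ^+ 2.
  apply: (@complexI R); rewrite -!/(iota _) !rmorph_sum.
  transitivity ((Z^t* *m Z) i i).
    rewrite mxE; apply: eq_bigr => j _.
    by rewrite -/(iota _) omE !mxE normCK mulrC.
  have -> : Z^t* *m Z = map_mx iota (U *m U^T).
    rewrite Zt /Z mulmxA -[_ *m P](mulmxA Uc) PP' mulmx1.
    by rewrite conjU map_mxM.
  by rewrite !mxE rmorph_sum; apply: eq_bigr => k _; rewrite !mxE expr2.
have detE : \det (gram U (\row_i (c i * t i))) = \prod_j \sum_i (c i * om j i) * t i.
  apply: (@complexI R); rewrite -!/(iota _) -det_map_mx -/(D _).
  have -> : \det (D (\row_i (c i * t i))) = \det (diag_mx d).
    by rewrite -dE !det_mulmx mulrAC -det_mulmx PP det1 mul1r.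
  rewrite det_diag rmorph_prod; apply: eq_bigr => j _.
  transitivity ((diag_mx d) j j); first by rewrite mxE eqxx mulr1n.
  rewrite -dE ZE rmorph_sum; apply: eq_bigr => i _.
  by rewrite -omE mxE -rmorphM; congr (iota _); ring.
rewrite detE; apply: le_trans (_ : \prod_j expR (\sum_i (c i * om j i) * ln (t i)) <= _).
  rewrite -expR_sum exchange_big/= ler_expR; apply: ler_sum => i _.
  by rewrite -omU mulr_sumr mulr_suml.
apply: ler_prod => j _; rewrite expR_ge0/=; apply: expR_jensen => // i.
by rewrite mulr_ge0.
Qed.

End GramDeterminant.

Section Cholesky.
Context {R : realType}.

Definition posdef n (M : 'M[R]_n) : Prop :=
  M^T = M /\ forall x : 'rV[R]_n, x != 0 -> 0 < (x *m M *m x^T) 0 0.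

Lemma cholesky n (M : 'M[R]_n) : posdef M -> exists N : 'M[R]_n, N *m N^T = M.
Proof.
elim: n => [|m IH] in M *; first by exists 0; apply/matrixP => -[].
rewrite -[M]/(M : 'M[R]_(1 + m)) -[M](@submxK _ 1 m 1 m).
set a := ulsubmx _; set b := ursubmx _; set c := dlsubmx _; set D := drsubmx _.
clearbody a b c D => {M} -[]; rewrite (@tr_block_mx _ 1 m 1 m).
move=> /(@eq_block_mx _ 1 m 1 m)[aT cT bT DT] Mpos.
have {}Mpos (x : 'rV[R]_1) (y : 'rV[R]_m) : (x != 0) || (y != 0) ->
    0 < (x *m a *m x^T + (y *m c *m x^T + x *m b *m y^T + y *m D *m y^T)) 0 0.
  move=> xy0; have := Mpos (row_mx x y); rewrite (@tr_row_mx _ 1 1 m).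
  rewrite (@mul_row_block _ 1 1 m 1 m) (@mul_row_col _ 1 1 m 1) !mulmxDl.
  rewrite !addrA; apply; apply/eqP; rewrite -(@row_mx0 _ 1 1 m).
  by move=> /(@eq_row_mx _ 1 1 m)[x0 y0]; move: xy0; rewrite x0 y0 !eqxx.
have a0 : 0 < a 0 0.
  have := Mpos 1%:M 0; rewrite oner_eq0/= => /(_ isT).
  by rewrite !mul0mx !mul1mx trmx0 mulmx0 trmx1 mulmx1 !addr0.
have [L LL] : exists L : 'M[R]_m, L *m L^T = D - (a 0 0)^-1 *: (c *m b).
  apply: IH; split.
    by rewrite linearB linearZ/= trmx_mul bT cT DT.
  (* For fixed y this first coordinate minimizes the form, and the minimum is the form of the Schur
     complement at y. *)
  move=> y y0; have := Mpos (- (a 0 0)^-1 *: (y *m c)) y; rewrite y0 orbT => /(_ isT).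
  set p := y *m c; have bp : b *m y^T = p^T by rewrite /p trmx_mul cT.
  have -> : y *m (D - (a 0 0)^-1 *: (c *m b)) *m y^T =
      y *m D *m y^T - (a 0 0)^-1 *: (p *m p^T).
    by rewrite mulmxBr mulmxBl -scalemxAr -scalemxAl !mulmxA -/p -[p *m b *m _]mulmxA bp.
  rewrite -[(- _ *: p) *m b *m y^T]mulmxA bp.
  move: (y *m D *m y^T) => q.
  do 4 rewrite ?mxE ?big_ord1.
  congr (0 < _); field; exact: lt0r_neq0.
exists (block_mx (Num.sqrt (a 0 0))%:M 0 ((Num.sqrt (a 0 0))^-1 *: c) L).
rewrite (@tr_block_mx _ 1 m 1 m) (@mulmx_block _ 1 m 1 m 1 m).
have ss : Num.sqrt (a 0 0) * Num.sqrt (a 0 0) = a 0 0.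
  by rewrite -expr2 sqr_sqrtr// ltW.
have s0 : Num.sqrt (a 0 0) != 0 by rewrite gt_eqF// sqrtr_gt0.
rewrite tr_scalar_mx trmx0 linearZ/= cT !mul0mx !mulmx0 !addr0 -scalar_mxM ss.
rewrite -mx11_scalar mul_scalar_mx mul_mx_scalar !scalerA mulfV// !scale1r.
apply: (f_equal (@block_mx _ 1 m 1 m a b c)).
by rewrite -scalemxAl -scalemxAr scalerA LL -invfM ss addrC subrK.
Qed.

End Cholesky.

(** * The Gaussian primitive and grids *)

Section GaussPrimitive.
Context {R : realType}.
Local Notation mu := (@lebesgue_measure R).

(** Of [F] only the derivative and the boundedness are kept. The value of the Gaussian integral is
    never computed, because it cancels in [slabs_volume_le]. *)
Lemma gauss_primitive : exists2 F : R -> R,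
  (forall x : R, is_derive x (1 : R) F (gauss_fun x)) & exists B, forall x, 0 <= F x <= B.
Proof.
pose F (x : R) := \int[mu]_(t in `]-oo, x]) gauss_fun t.
have intF (x : R) : mu.-integrable `]-oo, x] (EFin \o gauss_fun).
  by apply: integrableS (@integrableT_gauss R).
exists F.
  move=> x; have xu : x < x + 1 by rewrite ltrDl.
  have [dF F'] := continuous_FTC1 xu (intF _) (ltNyr x) (@continuous_gauss_fun R x).
  by apply: DeriveDef => //; rewrite -derive1E.
exists (\int[mu]_t gauss_fun t) => x; apply/andP; split.
  by apply: Rintegral_ge0 => t _; exact: gauss_fun_ge0.
rewrite [leRHS](_ : _ = F x + \int[mu]_(t in `]x, +oo[) gauss_fun t).
  by rewrite lerDl; apply: Rintegral_ge0 => t _; exact: gauss_fun_ge0.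
rewrite -Rintegral_setU//=.
- congr (\int[mu]_(t in _) _); apply/seteqP; split => t //= _.
  by rewrite !in_itv/= andbT; case: (leP t x) => h; [left|right].
- apply: integrableS (@integrableT_gauss R) => //.
  by apply: measurableU.
- rewrite disj_set2E; apply/eqP/seteqP; split => t //= -[].
  by rewrite !in_itv/= andbT leNgt => /negbTE ->.
Qed.

(** The derivative is at most 1 in absolute value, because 2 |t| <= 1 + t^2 <= e^(t^2). *)
Lemma gauss_fun_lip (x y : R) : `|gauss_fun y - gauss_fun x| <= `|y - x|.
Proof.
have dg (t : R) : is_derive t (1 : R) gauss_fun (- (2 * t) * gauss_fun t).
  rewrite /gauss_fun; apply: is_derive_eq.
  by rewrite /GRing.scale/=; ring.
wlog xy : x y / x <= y => [H|].
  have [xy|/ltW yx] := leP x y; first exact: H.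
  by rewrite distrC (distrC y); exact: H.
have cg : {within `[x, y], continuous (@gauss_fun R)}.
  by apply: continuous_subspaceT => t; exact: continuous_gauss_fun.
have [c _ ->] := MVT_segment xy (fun t _ => dg t) cg.
rewrite normrM ler_piMl// normrM normrN (ger0_norm (gauss_fun_ge0 _)).
rewrite /gauss_fun expRN ler_pdivrMr ?expR_gt0// mul1r.
apply: le_trans (expR_ge1Dx _); rewrite normrM ger0_norm//.
rewrite -[c ^+ 2](real_normK (num_real c)); have := sqr_ge0 (`|c| - 1); rewrite sqrrB1 expr2; lra.
Qed.

Lemma gauss_fun_ge (rho x : R) : `|x| <= rho -> gauss_fun rho <= gauss_fun x.
Proof.
move=> xr; rewrite /gauss_fun ler_expR lerN2 -[x ^+ 2](real_normK (num_real x)).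
by rewrite ler_sqr ?nnegrE// (le_trans _ xr).
Qed.

Section Primitive.
Variables (F : R -> R).
Hypothesis dF : forall x : R, is_derive x (1 : R) F (gauss_fun x).

Lemma gauss_primitive_MVT (x y : R) : x <= y ->
  exists2 c, x <= c <= y & F y - F x = gauss_fun c * (y - x).
Proof.
move=> xy; have cF : {within `[x, y], continuous F}.
  apply: continuous_subspaceT => t; apply: differentiable_continuous.
  by apply/derivable1_diffP; exact: ex_derive.
have [c cxy ->] := MVT_segment xy (fun t _ => dF t) cF.
by exists c => //; move: cxy; rewrite in_itv.
Qed.

Lemma gauss_primitive_taylor (x y : R) :
  `|F y - F x - gauss_fun x * (y - x)| <= (y - x) ^+ 2.
Proof.
suff [c cxy ->] : exists2 c, `|c - x| <= `|y - x| & F y - F x = gauss_fun c * (y - x).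
  rewrite -mulrBl normrM -[_ ^+ 2](real_normK (num_real _)) expr2 ler_wpM2r//.
  exact: le_trans (gauss_fun_lip _ _) cxy.
have [xy|/ltW xy] := leP x y.
  have [c /andP[xc cy] ->] := gauss_primitive_MVT xy.
  by exists c => //; rewrite !ger0_norm ?subr_ge0//; lra.
have [c /andP[xc cy] E] := gauss_primitive_MVT xy.
exists c; first by rewrite !ler0_norm ?subr_le0//; lra.
by rewrite -opprB E -mulrN opprB.
Qed.

(** Firm nonexpansiveness, from 0 <= F' <= 1. Applied at values of the transport [tau], where [F] is
    affine in the parameter, it says that [tau] is strongly monotone. *)
Lemma gauss_primitive_mono (x y : R) :
  (F y - F x) ^+ 2 <= (F y - F x) * (y - x).
Proof.
wlog xy : x y / x <= y => [H|].
  have [xy|/ltW yx] := leP x y; first exact: H.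
  by rewrite -sqrrN -mulrNN !opprB; exact: H.
have [c _ ->] := gauss_primitive_MVT xy.
rewrite expr2 ler_wpM2l//; first by rewrite mulr_ge0 ?gauss_fun_ge0 ?subr_ge0.
by rewrite ler_piMl ?subr_ge0// gauss_fun_le1.
Qed.

(** On [-rho, rho] the density is at least [gauss_fun rho]. This is what makes the transport
    Lipschitz once the Gaussian is truncated. *)
Lemma gauss_primitive_lower (rho x y : R) : `|x| <= rho -> `|y| <= rho ->
  gauss_fun rho * `|y - x| <= `|F y - F x|.
Proof.
wlog xy : x y / x <= y => [H|] hx hy.
  have [xy|/ltW yx] := leP x y; first exact: H.
  by rewrite distrC (distrC (F y)); exact: H.
have [c /andP[xc cy] ->] := gauss_primitive_MVT xy.
rewrite normrM (ger0_norm (gauss_fun_ge0 _)) ler_wpM2r//; apply: gauss_fun_ge.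
by rewrite ler_norml; move: hx hy; rewrite !ler_norml => /andP[? ?] /andP[? ?]; lra.
Qed.

End Primitive.
End GaussPrimitive.

Section GaussGrid.
Context {R : realType}.
Variables (F : R -> R) (rho : R) (N : nat).
Hypothesis dF : forall x : R, is_derive x (1 : R) F (gauss_fun x).
Hypothesis rho0 : 0 < rho.

Definition grid_step : R := 2 * rho / N.+1%:R.
Definition grid_point (k : nat) : R := - rho + k%:R * grid_step.
(** The mean of [gauss_fun] over the cell plus the mesh: it dominates the maximum by the Lipschitz
    bound, and its sum over the cells telescopes. *)
Definition cell_max (k : nat) : R :=
  (F (grid_point k.+1) - F (grid_point k)) / grid_step + grid_step.

Lemma grid_step_gt0 : 0 < grid_step.
Proof. by rewrite /grid_step divr_gt0 ?mulr_gt0. Qed.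

Lemma grid_pointS k : grid_point k.+1 = grid_point k + grid_step.
Proof. by rewrite /grid_point mulrSr mulrDl mul1r addrA. Qed.

Lemma gauss_fun_cell_max k s : grid_point k <= s <= grid_point k.+1 ->
  gauss_fun s <= cell_max k.
Proof.
have r0 := grid_step_gt0.
move=> /andP[ks sk]; rewrite /cell_max grid_pointS in sk *.
have [|c /andP[kc ck] ->] := gauss_primitive_MVT dF (x := grid_point k) (y := grid_point k + grid_step).
  by rewrite lerDl ltW.
rewrite addrAC subrr add0r mulfK ?gt_eqF//.
rewrite -lerBlDl; apply: le_trans (ler_norm _) _; apply: le_trans (gauss_fun_lip _ _) _.
by rewrite ler_norml; apply/andP; split; lra.
Qed.

Lemma cell_max_ge0 k : 0 <= cell_max k.
Proof.
apply: le_trans (gauss_fun_ge0 (grid_point k)) (gauss_fun_cell_max _).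
by rewrite lexx grid_pointS lerDl ltW// grid_step_gt0.
Qed.

Lemma sum_cell_max :
  \sum_(k < N.+1) grid_step * cell_max k = F rho - F (- rho) + 2 * rho * grid_step.
Proof.
have r0 := grid_step_gt0.
have stepN : grid_step * N.+1%:R = 2 * rho by rewrite divfK// pnatr_eq0.
rewrite (eq_bigr (fun k : 'I_N.+1 => (F (grid_point k.+1) - F (grid_point k)) + grid_step ^+ 2)); last first.
  by move=> k _; rewrite /cell_max mulrDr mulrCA divff ?gt_eqF// mulr1 expr2.
rewrite big_split/= sumr_const card_ord -(big_mkord xpredT (fun k => F (grid_point k.+1) - F (grid_point k))).
rewrite telescope_sumr// /grid_point mul0r addr0; congr (F _ - _ + _).
  by rewrite (mulrC N.+1%:R) stepN; ring.
by rewrite -[LHS]mulr_natr expr2 -[LHS]mulrA stepN mulrC.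
Qed.

Lemma grid_cell s : - rho <= s < rho ->
  exists k : 'I_N.+1, grid_point k <= s <= grid_point k.+1.
Proof.
have r0 := grid_step_gt0.
move=> /andP[s1 s2]; have t0 : 0 <= (s + rho) / grid_step.
  by rewrite divr_ge0 ?(ltW r0)//; lra.
have /andP[k1 k2] := truncn_itv t0.
have kN : (Num.truncn ((s + rho) / grid_step) < N.+1)%N.
  rewrite truncn_lt_nat// ltr_pdivrMr// /grid_step mulrC divfK ?pnatr_eq0//; lra.
exists (Ordinal kN) => /=; rewrite /grid_point.
rewrite ler_pdivlMr// in k1; rewrite ltr_pdivrMr// in k2.
by apply/andP; split; lra.
Qed.

End GaussGrid.

(** * A change of variables inequality by grids *)

Section Covering.
Context {R : realType}.
Variables (F : R -> R).
Hypothesis dF : forall x : R, is_derive x (1 : R) F (gauss_fun x).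

Lemma vmeasurable0 n : vmeasurable (set0 : set 'rV[R]_n).
Proof. by rewrite /vmeasurable preimage_set0. Qed.

Lemma volume0 n : volume (set0 : set 'rV[R]_n) = 0%E.
Proof. by rewrite volumeE preimage_set0 measure0. Qed.

Variables (n : nat) (X : set 'rV[R]_n) (phi : 'rV[R]_n -> 'rV[R]_n)
  (D : 'rV[R]_n -> 'M[R]_n) (A rho kappa : R).
Hypotheses (mX : vmeasurable X) (A0 : 0 <= A) (rho0 : 0 < rho) (kappa0 : 0 < kappa).
Hypothesis phi_bound : forall x, X x -> forall i, - rho <= phi x 0 i < rho.
Hypothesis D_det : forall x, X x ->
  kappa <= `|\det (D x)| * \prod_i gauss_fun (phi x 0 i).
(** [D x0] stands for the derivative of phi at x0, and the Taylor error is measured by the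
    displacement r of the images, since it is the image that is cut into cells. With [D_det], the
    case r = 0 contains the injectivity of phi. *)
Hypothesis phi_D : forall x x0 r, X x -> X x0 ->
  (forall j, `|(phi x - phi x0) 0 j| <= r) ->
  forall j, `|((x - x0) *m D x0 - (phi x - phi x0)) 0 j| <= A * r ^+ 2.

(* On the part of X sent by phi into a cell of side r, phi is D x0 up to r ^+ 2:
   this part lies in the preimage by D x0 of a box of side (1 + 2 A r) r. *)
Lemma volume_cell N (q : {ffun 'I_n -> 'I_N.+1}) :
  let r := grid_step rho N in
  exists Z : set 'rV[R]_n, [/\ vmeasurable Z,
    forall x, X x -> (forall j, grid_point rho N (q j) <= phi x 0 j <= grid_point rho N (q j).+1) -> Z x &
    (volume Z <= (kappa^-1 * \prod_j ((1 + 2 * A * r) * (r * cell_max F rho N (q j))))%:E)%E].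
Proof.
move=> r; have r0 : 0 < r := grid_step_gt0 N rho0.
have c0 : 0 <= 1 + 2 * A * r.
  by rewrite addr_ge0// mulr_ge0 ?(ltW r0)// mulr_ge0.
have [[x0 [Xx0 qx0]]|nq] := pselect (exists x0, X x0 /\
    forall j, grid_point rho N (q j) <= phi x0 0 j <= grid_point rho N (q j).+1); last first.
  exists set0; split=> [|x Xx qx|]; first exact: vmeasurable0.
    by apply: nq; exists x.
  rewrite volume0 lee_fin mulr_ge0 ?invr_ge0 ?(ltW kappa0)//.
  apply: prodr_ge0 => j _; apply: mulr_ge0 => //.
  by apply: mulr_ge0; [exact: ltW|exact: (@cell_max_ge0 _ F rho N dF rho0)].
pose l : 'rV[R]_n := \row_j (grid_point rho N (q j) - phi x0 0 j - A * r ^+ 2).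
pose u : 'rV[R]_n := \row_j (grid_point rho N (q j).+1 - phi x0 0 j + A * r ^+ 2).
have ul j : u 0 j - l 0 j = (1 + 2 * A * r) * r.
  by rewrite !mxE grid_pointS -/r; ring.
have lu j : l 0 j <= u 0 j.
  by rewrite -subr_ge0 ul mulr_ge0// ltW.
have detD : 0 < `|\det (D x0)|.
  rewrite lt_neqAle normr_ge0 andbT; apply: contraTneq (D_det Xx0) => <-.
  by rewrite mul0r -ltNge.
exists [set x | box l u (x *m D x0 + - (x0 *m D x0))]; split.
- exact: (vmeasurable_affine (D x0) (- (x0 *m D x0)) (vmeasurable_box l u)).
- move=> x Xx qx j /=; rewrite -mulmxBl.
  have h : forall j, `|(phi x - phi x0) 0 j| <= r.
    move=> i; rewrite !mxE; have := qx i; have := qx0 i.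
    rewrite !grid_pointS -/r => /andP[? ?] /andP[? ?].
    by rewrite ler_norml; apply/andP; split; lra.
  have := phi_D Xx Xx0 h j; have := qx j.
  rewrite [((x - x0) *m D x0 - _) 0 j]mxE; set y := ((x - x0) *m D x0) 0 j.
  rewrite !mxE ler_norml => /andP[? ?] /andP[? ?].
  by apply/andP; split; lra.
rewrite volume_affine//; last exact: vmeasurable_box.
  rewrite volume_box// -EFinM lee_fin.
  under eq_bigr do rewrite ul.
  (* By [D_det], the inverse of |det (D x0)| is at most [kappa^-1] times the Gaussian density at
     [phi x0], which [cell_max] dominates factor by factor. *)
  apply: le_trans (_ : kappa^-1 * (\prod_i gauss_fun (phi x0 0 i) * \prod_(i < n) ((1 + 2 * A * r) * r)) <= _).
    rewrite [leRHS]mulrA ler_wpM2r//.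
      by apply: prodr_ge0 => j _; rewrite mulr_ge0// ltW.
    by rewrite ler_pdivlMl// ler_pdivrMr// mulrC D_det.
  rewrite ler_wpM2l ?invr_ge0 ?(ltW kappa0)// -big_split/=.
  apply: ler_prod => j _; apply/andP; split.
    by rewrite mulr_ge0 ?gauss_fun_ge0// mulr_ge0// ltW.
  rewrite [leLHS]mulrCA ler_wpM2l// [leLHS]mulrC ler_wpM2l ?(ltW r0)//.
  exact: gauss_fun_cell_max.
by rewrite unitmxE unitfE -normr_gt0.
Qed.

(** Summed over all cells of R^n, the bounds of [volume_cell] factorize by distributivity into the
    n-th power of a one-dimensional Riemann sum. *)
Lemma volume_grid_le N :
  (volume X <= (kappa^-1 * ((1 + 2 * A * grid_step rho N) *
     (F rho - F (- rho) + 2 * rho * grid_step rho N)) ^+ n)%:E)%E.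
Proof.
set r := grid_step rho N; have /choice[Z /all_and3 [mZ XZ vZ]] := @volume_cell N.
have cov : X `<=` \bigcup_q Z q.
  move=> x Xx; have /choice[q hq] : forall j : 'I_n, exists k : 'I_N.+1,
      grid_point rho N k <= phi x 0 j <= grid_point rho N k.+1.
    by move=> j; apply: grid_cell => //; exact: phi_bound.
  by exists [ffun j => q j] => //; apply: XZ => // j; rewrite ffunE.
apply: (le_trans (volume_cover mX mZ cov)).
apply: (le_trans (lee_sum _ (fun q _ => vZ q))).
rewrite sumEFin lee_fin -mulr_sumr ler_wpM2l ?invr_ge0 ?(ltW kappa0)//.
pose f (j : 'I_n) (k : 'I_N.+1) := (1 + 2 * A * r) * (r * cell_max F rho N k).
rewrite -(bigA_distr_bigA f).
by rewrite /f prodr_const card_ord -mulr_sumr sum_cell_max.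
Qed.

Lemma volume_le_gauss : (volume X <= (kappa^-1 * (F rho - F (- rho)) ^+ n)%:E)%E.
Proof.
pose h (r : R) := kappa^-1 * ((1 + 2 * A * r) * (F rho - F (- rho) + 2 * rho * r)) ^+ n.
have vh N : (volume X <= (h (grid_step rho N))%:E)%E := volume_grid_le N.
have v0 := volume_ge0 X.
have vfin : volume X \is a fin_num.
  by rewrite ge0_fin_numE// (le_lt_trans (vh 0))// ltry.
rewrite -(fineK vfin) lee_fin.
have {}vh N : fine (volume X) <= h (grid_step rho N) by rewrite -lee_fin fineK.
have -> : kappa^-1 * (F rho - F (- rho)) ^+ n = h 0.
  by rewrite /h !mulr0 !addr0 mul1r.
have cs : grid_step rho N @[N --> \oo] --> 0.
  by rewrite -(mulr0 (2 * rho)); apply: cvgMl_tmp; exact: cvg_harmonic.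
have hl : h (grid_step rho N) @[N --> \oo] --> h 0.
  have lin (a b : R) : a + b * grid_step rho N @[N --> \oo] --> a + b * 0.
    by apply: cvgD; [exact: cvg_cst|exact: cvgMl_tmp].
  apply: cvgMl_tmp; apply: (cvg_comp _ (fun x => x ^+ n) _ (@exprn_continuous _ n _)).
  by apply: cvgM; exact: lin.
rewrite -(cvg_lim _ hl)//.
apply: limr_ge; first exact: cvgP hl.
by near=> N; exact: vh.
Unshelve. all: by end_near.
Qed.

End Covering.

(** * Slabs cut out by a tight frame *)

Section Frame.
Context {R : realType} (m n : nat).
Variables (U : 'M[R]_(m, n)) (c : 'I_m -> R).
Hypotheses (c0 : forall i, 0 <= c i) (tight : gram U (\row_i c i) = 1%:M).

Lemma gramE (w : 'rV[R]_m) j k : gram U w j k = \sum_i w 0 i * U i j * U i k.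
Proof.
rewrite mxE; apply: eq_bigr => i _.
by rewrite mul_mx_diag !mxE [U i j * _]mulrC.
Qed.

Definition dot (x : 'rV[R]_n) i : R := \sum_k x 0 k * U i k.

Lemma mul_gram (w : 'rV[R]_m) x j : (x *m gram U w) 0 j = \sum_i w 0 i * dot x i * U i j.
Proof.
rewrite mxE; under eq_bigr do rewrite gramE mulr_sumr.
rewrite exchange_big/=; apply: eq_bigr => i _.
rewrite /dot mulr_sumr mulr_suml; apply: eq_bigr => k _; ring.
Qed.

Lemma frame_expand x j : \sum_i c i * dot x i * U i j = x 0 j.
Proof.
rewrite -[in RHS](mulmx1 x) -tight mul_gram.
by apply: eq_bigr => i _; rewrite mxE.
Qed.

(** The synthesis operator of the frame: for the weights c it is adjoint to x |-> (<x, u_i>)_i, as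
    [sum_synth] expresses. *)
Definition synth (a : 'I_m -> R) : 'rV[R]_n := \row_j \sum_i c i * a i * U i j.

Lemma sum_synth a (y : 'rV[R]_n) :
  \sum_j synth a 0 j * y 0 j = \sum_i c i * a i * dot y i.
Proof.
under eq_bigr do rewrite mxE mulr_suml.
rewrite exchange_big/=; apply: eq_bigr => i _.
rewrite /dot mulr_sumr; apply: eq_bigr => k _; ring.
Qed.

Lemma frame_norm (y : 'rV[R]_n) : \sum_i c i * dot y i ^+ 2 = \sum_j y 0 j ^+ 2.
Proof.
transitivity (\sum_j synth (dot y) 0 j * y 0 j).
  by rewrite sum_synth; apply: eq_bigr => i _; rewrite -mulrA -expr2.
by apply: eq_bigr => j _; rewrite mxE frame_expand expr2.
Qed.

(** By [frame_norm], [dot] is an isometry into a weighted l^2 space, so its adjoint [synth] is a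
    contraction: expand sum_i c_i (a_i - <v, u_i>)^2 >= 0. *)
Lemma synth_norm_le a : \sum_j synth a 0 j ^+ 2 <= \sum_i c i * a i ^+ 2.
Proof.
set v := synth a.
have : 0 <= \sum_i c i * (a i - dot v i) ^+ 2.
  by apply: sumr_ge0 => i _; rewrite mulr_ge0// sqr_ge0.
under eq_bigr do rewrite sqrrB mulrDr mulrBr.
rewrite big_split/= sumrB frame_norm.
have -> : \sum_i c i * (a i * dot v i *+ 2) = (\sum_j v 0 j ^+ 2) *+ 2.
  under [in RHS]eq_bigr do rewrite expr2.
  by rewrite sum_synth -sumrMnl; apply: eq_bigr => i _; rewrite mulrnAr mulrA.
by rewrite mulr2n; lra.
Qed.

Definition sqnorm i : R := \sum_k U i k ^+ 2.

Lemma sum_sqnorm : \sum_i c i * sqnorm i = n%:R.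
Proof.
have : \tr (gram U (\row_i c i)) = n%:R by rewrite tight mxtrace1.
move=> <-; rewrite /mxtrace; under [RHS]eq_bigr do rewrite gramE.
rewrite exchange_big/=; apply: eq_bigr => i _; rewrite /sqnorm mulr_sumr.
by apply: eq_bigr => k _; rewrite mxE -mulrA expr2.
Qed.

Lemma sqnorm_ge0 i : 0 <= sqnorm i.
Proof. by apply: sumr_ge0 => k _; exact: sqr_ge0. Qed.

Lemma sqnorm_eq0 i : sqnorm i = 0 -> forall k, U i k = 0.
Proof.
move=> /eqP; rewrite psumr_eq0 => [/allP h k|k _]; last exact: sqr_ge0.
by have := h k (mem_index_enum _); rewrite /= sqrf_eq0 => /eqP.
Qed.

(* |u_i|, except that it must stay positive when u_i = 0. *)
Definition scale_factor i : R := if sqnorm i == 0 then 1 else Num.sqrt (sqnorm i).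

Lemma scale_factor_gt0 i : 0 < scale_factor i.
Proof.
rewrite /scale_factor; case: eqVneq => // h.
by rewrite sqrtr_gt0 lt_neqAle eq_sym h sqnorm_ge0.
Qed.

(** From w ln w >= w - 1 with w = |u_i|^2, the sum is at least half of sum_i c_i (|u_i|^2 - 1),
    which is 0 since both families of weights total n. *)
Lemma sum_ln_scale_factor_ge0 : \sum_i c i = n%:R ->
  0 <= \sum_i c i * sqnorm i * ln (scale_factor i).
Proof.
move=> cn; have s0 : \sum_i (c i * sqnorm i - c i) / 2 = 0.
  by rewrite -mulr_suml sumrB sum_sqnorm cn subrr mul0r.
rewrite -[leLHS]s0; apply: ler_sum => i _; rewrite -[X in _ - X]mulr1 -mulrBr -!mulrA.
rewrite ler_wpM2l// /scale_factor; case: eqVneq => [->|h].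
  by rewrite mul0r; lra.
have w0 : 0 < sqnorm i by rewrite lt_neqAle eq_sym h sqnorm_ge0.
have -> : ln (Num.sqrt (sqnorm i)) = ln (sqnorm i) / 2.
  by rewrite -[in RHS](sqr_sqrtr (ltW w0)) lnXn ?sqrtr_gt0// mulr2n; lra.
rewrite mulrA ler_pM2r ?invr_gt0//.
have := @le_ln1Dx R ((sqnorm i)^-1 - 1).
rewrite ltrBrDl subrr invr_gt0 => /(_ w0); rewrite addrC subrK lnV ?posrE//.
move/(ler_wpM2l (ltW w0)); rewrite mulrN [leRHS]mulrBr mulfV ?gt_eqF// mulr1; lra.
Qed.

(** Replacing [scale_factor] by |u_i| alters only terms with u_i = 0, which contribute nothing to
    [synth]. The resulting weights c_i |u_i|^2 are the exponents of [det_gram_ge]. *)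
Lemma synth_scale_norm_le (t : 'I_m -> R) :
  \sum_j synth (fun i => scale_factor i * t i) 0 j ^+ 2 <= \sum_i c i * sqnorm i * t i ^+ 2.
Proof.
have -> : synth (fun i => scale_factor i * t i) = synth (fun i => Num.sqrt (sqnorm i) * t i).
  apply/rowP => j; rewrite !mxE; apply: eq_bigr => i _.
  rewrite /scale_factor; case: eqVneq => // h.
  by rewrite (sqnorm_eq0 h) !mulr0.
apply: le_trans (synth_norm_le _) _; rewrite le_eqVlt; apply/orP; left; apply/eqP.
by apply: eq_bigr => i _; rewrite exprMn sqr_sqrtr ?sqnorm_ge0// mulrA.
Qed.

End Frame.

Lemma sum_abs_sqr_le {R : realType} n (a : 'I_n -> R) :
  (\sum_j a j) ^+ 2 <= n%:R * \sum_j a j ^+ 2.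
Proof.
case: n a => [|n] a; first by rewrite !big_ord0 mulr0 expr0n.
set Y := \sum_j a j; set q := \sum_j _; set N : R := n.+1%:R.
have N0 : 0 < N by rewrite ltr0n.
have : 0 <= \sum_j (N * a j - Y) ^+ 2 by apply: sumr_ge0 => j _; exact: sqr_ge0.
have -> : \sum_j (N * a j - Y) ^+ 2 = N * (N * q - Y ^+ 2).
  rewrite (eq_bigr (fun j => N ^+ 2 * a j ^+ 2 + (- (2 * N * Y)) * a j + Y ^+ 2)).
    rewrite !big_split/= -!mulr_sumr sumr_const card_ord -mulr_natl -/N -/Y -/q; ring.
  by move=> j _; ring.
by rewrite pmulr_rge0// subr_ge0.
Qed.

(** * Transport of the slabs to the Gaussian measure *)

Section SlabVolume.
Context {R : realType} (m n : nat).
Variables (U : 'M[R]_(m, n)) (c : 'I_m -> R).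
Hypotheses (c0 : forall i, 0 <= c i) (tight : gram U (\row_i c i) = 1%:M).
Hypothesis cn : \sum_i c i = n%:R.
Variable (F : R -> R).
Hypothesis dF : forall x : R, is_derive x (1 : R) F (gauss_fun x).

Definition slabs : set 'rV[R]_n := [set x | forall i, `|dot U x i| <= 1].

Lemma vmeasurable_slabs : vmeasurable slabs.
Proof.
have := vmeasurable_affine U^T 0 (vmeasurable_box (const_mx (-1)) (const_mx 1)).
congr vmeasurable; apply/seteqP; split => x /= h i.
  have := h i; rewrite !mxE addr0 -ler_norml; congr (`|_| <= 1).
  by apply: eq_bigr => k _; rewrite mxE.
rewrite !mxE addr0 -ler_norml; have := h i; congr (`|_| <= 1).
by apply: eq_bigr => k _; rewrite mxE.
Qed.

Lemma dotB x y i : dot U (x - y) i = dot U x i - dot U y i.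
Proof. by rewrite /dot -sumrB; apply: eq_bigr => k _; rewrite !mxE mulrBl. Qed.

Section FixedRadius.
Variable r0 : R.
Hypothesis r0_gt0 : 0 < r0.

(** The length of [-1, 1] divided by the Gaussian mass of [-r0, r0]. *)
Let b := 2 / (F r0 - F (- r0)).

Lemma gauss_primitive_gap : 0 < F r0 - F (- r0).
Proof.
have [|z _ ->] := gauss_primitive_MVT dF (x := - r0) (y := r0); first by have := r0_gt0; lra.
by rewrite mulr_gt0 ?expR_gt0//; have := r0_gt0; lra.
Qed.

Let b0 : 0 < b. Proof. by rewrite divr_gt0// gauss_primitive_gap. Qed.

(** [tau] carries the uniform law of [-1, 1] to the Gaussian truncated to [-r0, r0]. Formally tau' =
    1 / (b * gauss_fun tau); only the integrated equation is kept. *)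
Lemma transport_point : exists tau : R -> R, forall s, `|s| <= 1 ->
  `|tau s| <= r0 /\ F (tau s) = F (- r0) + (s + 1) / b.
Proof.
suff /choice[tau tauP] : forall s, exists t, `|s| <= 1 ->
  `|t| <= r0 /\ F t = F (- r0) + (s + 1) / b by exists tau.
move=> s; have [s1|] := boolP (`|s| <= 1); last by exists 0.
have cF : {within `[- r0, r0], continuous F}.
  apply: continuous_subspaceT => t; apply: differentiable_continuous.
  by apply/derivable1_diffP; exact: ex_derive.
have gap := gauss_primitive_gap.
have sb : F r0 = F (- r0) + 2 / b by rewrite /b; field; rewrite gt_eqF.
have [| |t] := IVT (v := F (- r0) + (s + 1) / b) _ cF; first by have := r0_gt0; lra.
  move: s1; rewrite ler_norml => /andP[s1 s2].
  rewrite min_l ?max_r; [|lra|lra]; rewrite sb lerDl lerD2l divr_ge0 ?ler_pM2r ?invr_gt0 ?(ltW b0)//=; lra.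
by rewrite in_itv/= -ler_norml => t1 Ft; exists t.
Qed.

Lemma slabs_volume_le_radius : exists2 rho, 0 < rho &
  (volume slabs <= ((b * (F rho - F (- rho))) ^+ n)%:E)%E.
Proof.
have [tau tauP] := transport_point.
pose s (x : 'rV[R]_n) i := dot U x i.
pose kap := scale_factor U.
have kap0 i : 0 < kap i := scale_factor_gt0 U i.
pose phi x := synth U c (fun i => kap i * tau (s x i)).
pose g (x : 'rV[R]_n) i := gauss_fun (tau (s x i)).
(* The formal derivative of phi, by the equation for tau'. *)
pose D x := gram U (\row_i (c i * (kap i / (b * g x i)))).
pose g0 := gauss_fun r0.
have g0_gt0 : 0 < g0 by exact: expR_gt0.
have g_gt0 x i : 0 < g x i by exact: expR_gt0.
have tau_r0 x i : slabs x -> `|tau (s x i)| <= r0 by move=> /(_ i)/tauP[].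
have gg0 x i : slabs x -> g0 <= g x i by move=> Xx; apply: gauss_fun_ge; exact: tau_r0.
pose Mx := \sum_i \sum_j `|U i j|.
have UMx i j : `|U i j| <= Mx.
  rewrite /Mx (bigD1 i)//= (bigD1 j)//= -addrA lerDl addr_ge0//.
    by apply: sumr_ge0.
  by apply: sumr_ge0 => k _; apply: sumr_ge0.
have Mx0 : 0 <= Mx by apply: sumr_ge0 => i _; apply: sumr_ge0.
(* A positive lower bound of all the [kap i]; the 1 covers an empty family. *)
pose k0 := (\sum_i (kap i)^-1 + 1)^-1.
have k0_gt0 : 0 < k0.
  by rewrite invr_gt0 ltr_wpDl// sumr_ge0// => i _; rewrite invr_ge0 ltW.
have k0_le i : k0 <= kap i.
  rewrite -[leRHS]invrK lef_pV2 ?posrE ?invr_gt0//; last first.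
    by rewrite ltr_wpDl// sumr_ge0// => j _; rewrite invr_ge0 ltW.
  rewrite (bigD1 i)//= -addrA lerDl addr_ge0// sumr_ge0// => j _.
  by rewrite invr_ge0 ltW.
(* For a displacement r of phi, [K * r] bounds that of each <x, u_i>, [K / (b * g0) * r] that of
   each [tau (s x i)], and [A] collects the quadratic remainders. The values of these constants
   disappear as the mesh tends to 0. The 1 in [rho] makes the upper bound on phi strict. *)
pose K := Mx * (n%:R * (b / k0)).
pose A := \sum_i c i * kap i * Mx * (K / (b * g0)) ^+ 2 / g0.
pose rho := 1 + \sum_i c i * kap i * r0 * Mx.
have K0 : 0 <= K by rewrite mulr_ge0// mulr_ge0// divr_ge0 ?ltW.
have bg0 : 0 < b * g0 by rewrite mulr_gt0.
have A0 : 0 <= A.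
  apply: sumr_ge0 => i _; rewrite divr_ge0 ?(ltW g0_gt0)// mulr_ge0 ?sqr_ge0//.
  by rewrite mulr_ge0// mulr_ge0// ltW.
have rho0 : 0 < rho.
  rewrite ltr_pwDl//; apply: sumr_ge0 => i _.
  by rewrite mulr_ge0// mulr_ge0 ?(ltW r0_gt0)// mulr_ge0// ltW.
exists rho => //.
have phi_bound x : slabs x -> forall j, - rho <= phi x 0 j < rho.
  move=> Xx j; have : `|phi x 0 j| <= rho - 1.
    rewrite /rho addrAC subrr add0r mxE; apply: le_trans (ler_norm_sum _ _ _) _.
    apply: ler_sum => i _; rewrite !normrM (ger0_norm (c0 i)) (gtr0_norm (kap0 i)).
    rewrite [c i * (_ * _)]mulrA ler_pM// ?mulr_ge0// ?(ltW (kap0 i))//.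
    by rewrite ler_wpM2l ?mulr_ge0 ?(ltW (kap0 i))// tau_r0.
  by rewrite ler_norml => /andP[? ?]; apply/andP; split; lra.
have D_det x : slabs x -> b ^- n <= `|\det (D x)| * \prod_j gauss_fun (phi x 0 j).
  move=> Xx; have bg i : 0 < b * g x i by exact: mulr_gt0.
  have detD : 0 < \det (D x) /\ expR (\sum_i c i * sqnorm U i * ln (kap i / (b * g x i))) <= \det (D x).
    have t0 i : 0 < kap i / (b * g x i) by exact: divr_gt0.
    have H := det_gram_ge c0 t0 tight.
    by split => //; apply: lt_le_trans H; exact: expR_gt0.
  rewrite gtr0_norm; last by case: detD.
  have -> : \prod_j gauss_fun (phi x 0 j) = expR (- \sum_j phi x 0 j ^+ 2).
    by rewrite -sumrN expR_sum.
  apply: le_trans (_ : expR (\sum_i c i * sqnorm U i * ln (kap i / (b * g x i))) * expR (- \sum_j phi x 0 j ^+ 2) <= _); last first.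
    by rewrite ler_wpM2r ?expR_ge0//; case: detD.
  rewrite -expRD -[leLHS]lnK ?posrE ?invr_gt0 ?exprn_gt0// ler_expR.
  rewrite lnV ?posrE ?exprn_gt0// lnXn//.
  (* Since - ln g = tau^2 and the weights c_i |u_i|^2 total n, three terms appear: the first is
     nonnegative, the second is the logarithm of [b ^- n], the third dominates the squared norm of
     [phi x]. *)
  have -> : \sum_i c i * sqnorm U i * ln (kap i / (b * g x i)) =
      \sum_i c i * sqnorm U i * ln (kap i) - ln b *+ n + \sum_i c i * sqnorm U i * tau (s x i) ^+ 2.
    rewrite -mulr_natl -(sum_sqnorm tight) mulr_suml -sumrB -big_split/=.
    apply: eq_bigr => i _; rewrite ln_div ?posrE ?bg// lnM ?posrE//.
    by rewrite [ln (g x i)]expRK; ring.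
  have := synth_scale_norm_le c0 tight (fun i => tau (s x i)).
  have := sum_ln_scale_factor_ge0 c0 tight cn.
  rewrite -/(phi x); lra.
have phi_D x x0 r : slabs x -> slabs x0 -> (forall j, `|(phi x - phi x0) 0 j| <= r) ->
    forall j, `|((x - x0) *m D x0 - (phi x - phi x0)) 0 j| <= A * r ^+ 2.
  move=> Xx Xx0 hr j.
  pose d i := s x i - s x0 i; pose dl i := tau (s x i) - tau (s x0 i).
  set y := x - x0; have dE i : dot U y i = d i by rewrite dotB.
  have Fd i : F (tau (s x i)) - F (tau (s x0 i)) = d i / b.
    have [_ ->] := tauP _ (Xx i); have [_ ->] := tauP _ (Xx0 i).
    by rewrite opprD addrACA subrr add0r -mulrBl opprD addrACA subrr addr0.
  have vE : phi x - phi x0 = synth U c (fun i => kap i * dl i).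
    apply/rowP => k; rewrite !mxE -sumrB; apply: eq_bigr => i _.
    by rewrite /dl; ring.
  have r_ge0 : 0 <= r by apply: le_trans (hr j).
  pose Y := \sum_k `|y 0 k|.
  have Y0 : 0 <= Y by apply: sumr_ge0.
  have mono i : d i ^+ 2 / b <= dl i * d i.
    have := gauss_primitive_mono dF (tau (s x0 i)) (tau (s x i)).
    rewrite Fd -(ler_pM2l b0); congr (_ <= _); first by field; rewrite gt_eqF.
    by rewrite -/(dl i); field; rewrite gt_eqF.
  (* phi is strongly monotone: by [mono] and [frame_norm], its increment paired with y is at least
     k0 / b times |y|^2. This controls the increment y of x by that of phi. *)
  have qY : k0 / b * \sum_k y 0 k ^+ 2 <= r * Y.
    rewrite -(frame_norm tight); under eq_bigr do rewrite dE.
    apply: le_trans (_ : \sum_k (phi x - phi x0) 0 k * y 0 k <= _).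
      rewrite vE sum_synth mulr_sumr; apply: ler_sum => i _; rewrite dE.
      rewrite -[leRHS]mulrA -[kap i * dl i * d i]mulrA mulrCA ler_wpM2l//.
      apply: le_trans (_ : kap i * (d i ^+ 2 / b) <= _).
        by rewrite -mulrA [b^-1 * _]mulrC ler_wpM2r// divr_ge0 ?sqr_ge0// ltW.
      by rewrite ler_wpM2l// ltW.
    rewrite mulr_sumr; apply: ler_sum => k _.
    by apply: le_trans (ler_norm _) _; rewrite normrM ler_wpM2r.
  have YK : Y <= n%:R * (b / k0) * r.
    have [->|Yn0] := eqVneq Y 0; first by rewrite mulr_ge0// mulr_ge0// divr_ge0// ltW.
    have Ygt0 : 0 < Y by rewrite lt_neqAle eq_sym Yn0.
    rewrite -(ler_pM2r Ygt0) -expr2 (le_trans (sum_abs_sqr_le _))//.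
    under eq_bigr do rewrite real_normK ?num_real//.
    have bk : 0 < b / k0 by exact: divr_gt0.
    rewrite -!mulrA ler_wpM2l// [leRHS](_ : _ = (b / k0) * (r * Y)); last by rewrite !mulrA.
    by rewrite -ler_pdivrMl// invf_div.
  have dK i : `|d i| <= K * r.
    rewrite -dE /dot; apply: le_trans (ler_norm_sum _ _ _) _.
    apply: le_trans (_ : Mx * Y <= _); last by rewrite /K -mulrA ler_wpM2l.
    rewrite mulr_sumr; apply: ler_sum => k _.
    by rewrite normrM mulrC ler_wpM2r.
  have dlK i : `|dl i| <= K / (b * g0) * r.
    have := gauss_primitive_lower dF (tau_r0 x0 i Xx0) (tau_r0 x i Xx).
    rewrite Fd normrM -ler_pdivlMl// => /le_trans; apply.
    rewrite [`|b^-1|]gtr0_norm ?invr_gt0//.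
    have -> : K / (b * g0) * r = g0^-1 * (K * r / b) by rewrite invfM; ring.
    by rewrite ler_wpM2l ?invr_ge0 ?(ltW g0_gt0)// ler_wpM2r// invr_ge0 ltW.
  (* The Taylor remainder of [tau] at [s x0 i] is that of [F] at [tau (s x0 i)], up to sign, divided
     by the density there. *)
  have rest i : `|d i / (b * g x0 i) - dl i| <= (K / (b * g0)) ^+ 2 / g0 * r ^+ 2.
    have -> : d i / (b * g x0 i) - dl i = (d i / b - g x0 i * dl i) / g x0 i.
      by field; rewrite !gt_eqF.
    rewrite -Fd normrM [X in _ * X]gtr0_norm ?invr_gt0// mulrAC.
    have dl2 : dl i ^+ 2 <= (K / (b * g0)) ^+ 2 * r ^+ 2.
      by rewrite -exprMn -[dl i ^+ 2](real_normK (num_real _)) lerXn2r// nnegrE mulr_ge0// divr_ge0// ltW.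
    apply: ler_pM => //; first by rewrite invr_ge0 ltW.
      by apply: le_trans dl2; exact: gauss_primitive_taylor.
    by rewrite lef_pV2 ?posrE// gg0.
  have -> : (y *m D x0 - (phi x - phi x0)) 0 j =
      \sum_i c i * kap i * (d i / (b * g x0 i) - dl i) * U i j.
    rewrite [LHS]mxE vE [X in _ + X]mxE [X in _ - X]mxE mul_gram -sumrB.
    by apply: eq_bigr => i _; rewrite mxE dE; ring.
  rewrite /A mulr_suml; apply: le_trans (ler_norm_sum _ _ _) _.
  apply: ler_sum => i _; rewrite !normrM (ger0_norm (c0 i)) (gtr0_norm (kap0 i)).
  have -> : c i * kap i * Mx * (K / (b * g0)) ^+ 2 / g0 * r ^+ 2 =
      c i * kap i * ((K / (b * g0)) ^+ 2 / g0 * r ^+ 2 * Mx) by ring.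
  rewrite -[leLHS]mulrA ler_wpM2l ?mulr_ge0 ?(ltW (kap0 i))//.
  by apply: ler_pM.
have kappa0 : 0 < b ^- n by rewrite invr_gt0 exprn_gt0.
have := volume_le_gauss dF vmeasurable_slabs A0 rho0 kappa0 phi_bound D_det phi_D.
by rewrite invrK -exprMn.
Qed.

End FixedRadius.
End SlabVolume.

Lemma le_expr_harmonic {R : realType} (v a : R) n :
  (forall N, v <= (a * (1 + harmonic N)) ^+ n) -> v <= a ^+ n.
Proof.
move=> H; have hl : (a * (1 + harmonic N)) ^+ n @[N --> \oo] --> (a * (1 + 0)) ^+ n.
  apply: (cvg_comp _ (fun x => x ^+ n) _ (@exprn_continuous _ n _)).
  by apply: cvgMl_tmp; apply: cvgD; [exact: cvg_cst|exact: cvg_harmonic].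
rewrite addr0 mulr1 in hl; rewrite -(cvg_lim _ hl)//; apply: limr_ge; first exact: cvgP hl.
by near=> N; exact: H.
Unshelve. all: by end_near.
Qed.

(** The mass of [-rho, rho] is at most the total mass [sup S], whatever rho is, and the truncation
    radius can be taken so that b is close to 2 / sup S. Their product is then close to 2. *)
Lemma slabs_volume_le {R : realType} m n (U : 'M[R]_(m, n)) (c : 'I_m -> R) :
  (forall i, 0 <= c i) -> gram U (\row_i c i) = 1%:M -> \sum_i c i = n%:R ->
  (volume (slabs U) <= (2 ^+ n)%:E)%E.
Proof.
move=> c0 tight cn.
have [F dF [B FB]] := @gauss_primitive R.
pose G z := F z - F (- z).
pose S := [set G z | z in [set z | 0 < z]].
have hS : has_sup S.
  split; first by exists (G 1), 1 => //=.
  exists B => _ [z _ <-]; rewrite /G.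
  have /andP[? ?] := FB z; have /andP[? ?] := FB (- z); lra.
have GL z : 0 < z -> G z <= sup S.
  by move=> z0; apply: ub_le_sup; [case: hS|exists z].
have L0 : 0 < sup S.
  by apply: lt_le_trans (GL 1 _) => //; exact: (gauss_primitive_gap dF).
have v0 := volume_ge0 (slabs U).
have bound N : exists2 z, 0 < z & 2 / G z <= 2 * (1 + harmonic N) / sup S.
  (* Losing the fraction 1 / (N + 2) of the mass costs exactly the factor 1 + 1 / (N + 1). *)
  have e0 : 0 < sup S / N.+2%:R by rewrite divr_gt0.
  have [_ [z z0 <-] zL] := sup_adherent e0 hS.
  exists z => //; rewrite -mulrA ler_pM2l// -[leLHS]div1r ler_pdivrMr; last first.
    exact: (gauss_primitive_gap dF).
  rewrite mulrAC ler_pdivlMr// mul1r /harmonic/=.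
  rewrite -ler_pdivrMl; last by rewrite ltr_pwDl.
  apply: le_trans (ltW zL); rewrite le_eqVlt; apply/orP; left; apply/eqP.
  have -> : N.+2%:R = N.+1%:R + 1 :> R by rewrite natr1.
  have : 0 < N.+1%:R :> R by rewrite ltr0n.
  by move: (N.+1%:R : R) => x x0; field; rewrite !gt_eqF//; lra.
have vfin : volume (slabs U) \is a fin_num.
  have [rho _ h] := slabs_volume_le_radius c0 tight cn dF (@ltr01 R).
  by rewrite ge0_fin_numE// (le_lt_trans h)// ltry.
rewrite -(fineK vfin) lee_fin; apply: le_expr_harmonic => N.
have [z z0 zL] := bound N.
have [rho rho0 h] := slabs_volume_le_radius c0 tight cn dF z0.
have Gz : 0 < G z := gauss_primitive_gap dF z0.
have Grho : 0 < G rho := gauss_primitive_gap dF rho0.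
have Gz2 : 0 <= 2 / G z by rewrite divr_ge0// ltW.
rewrite -lee_fin fineK// (le_trans h)// lee_fin; apply: lerXn2r.
- by rewrite nnegrE; apply: mulr_ge0 => //; exact: ltW.
- by rewrite nnegrE mulr_ge0// addr_ge0// harmonic_ge0.
have -> : 2 * (1 + harmonic N) = 2 * (1 + harmonic N) / sup S * sup S.
  by rewrite divfK// gt_eqF.
by apply: ler_pM => //; [exact: ltW|exact: GL].
Qed.

(** * Quadratic forms and rank-one perturbations *)

Section QuadraticForms.
Context {R : realType}.

Lemma mul_tr_self n (b : 'rV[R]_n) : (b *m b^T) 0 0 = \sum_k b 0 k ^+ 2.
Proof. by rewrite mxE; apply: eq_bigr => k _; rewrite mxE expr2. Qed.

(** If the form vanishes at x, then at x - t y with y = x M it equals -2 t |y|^2 up to O(t^2), so y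
    = 0, and x = 0 by invertibility. *)
Lemma psd_unit_posdef n (M : 'M[R]_n) : M^T = M ->
  (forall x : 'rV[R]_n, 0 <= (x *m M *m x^T) 0 0) -> M \in unitmx -> posdef M.
Proof.
move=> MT psd uM; split => // x x0; rewrite lt_neqAle psd andbT eq_sym.
apply: contra_neq x0 => q0.
suff xM0 : x *m M = 0 by rewrite -[x](mulmxK uM) xM0 mul0mx.
have [y yE] : exists y, y = x *m M by exists (x *m M).
have yy := mul_tr_self y.
have E t : ((x - t *: y) *m M *m (x - t *: y)^T) 0 0 =
    t * (t * (y *m M *m y^T) 0 0 - 2 * \sum_k y 0 k ^+ 2).
  have h1 : (x *m M *m y^T) 0 0 = \sum_k y 0 k ^+ 2 by rewrite -yE yy.
  have h2 : (y *m M *m x^T) 0 0 = \sum_k y 0 k ^+ 2.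
    have -> : y *m M *m x^T = (x *m M *m y^T)^T by rewrite !trmx_mul trmxK MT mulmxA.
    by rewrite mxE h1.
  have -> : (x - t *: y)^T = x^T - t *: y^T by apply/matrixP => i j; rewrite !mxE.
  have -> : (x - t *: y) *m M *m (x^T - t *: y^T) = x *m M *m x^T -
      t *: (x *m M *m y^T) - t *: (y *m M *m x^T) + t ^+ 2 *: (y *m M *m y^T).
    rewrite mulmxBr !mulmxBl -!scalemxAr -!scalemxAl.
    move: (x *m M *m x^T) (x *m M *m y^T) (y *m M *m x^T) (y *m M *m y^T) => a b c d.
    by apply/matrixP => i j; rewrite !mxE; ring.
  move: (x *m M *m x^T) (x *m M *m y^T) (y *m M *m x^T) (y *m M *m y^T) q0 h1 h2.
  by move=> a b c d a0 b0 c0; rewrite !mxE a0 b0 c0; ring.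
set Q := (y *m M *m y^T) 0 0 in E; set s := \sum_k _ in E.
have s0 : 0 <= s by apply: sumr_ge0 => k _; exact: sqr_ge0.
suff s00 : s = 0.
  rewrite -yE; apply/rowP => k; rewrite [RHS]mxE; apply/eqP; rewrite -sqrf_eq0.
  move/eqP: s00; rewrite psumr_eq0; first by move/allP/(_ k (mem_index_enum _)).
  by move=> j _; exact: sqr_ge0.
apply/eqP; rewrite eq_le s0 andbT leNgt; apply/negP => sgt0.
have Q0 : 0 <= Q := psd y.
(* For this t one has t Q < s, so t (t Q - 2 s) is negative; the 1 allows for Q = 0. *)
have := psd (x - (s / (Q + 1)) *: y); rewrite E leNgt => /negP; apply.
have Q1 : 0 < Q + 1 by rewrite ltr_wpDl.
rewrite pmulr_rlt0 ?divr_gt0// subr_lt0.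
rewrite mulrAC ltr_pdivrMr//; nra.
Qed.

(** Matrix determinant lemma: a bordered matrix is factored through each of its two Schur
    complements. *)
Lemma det_rank1_update n (al be : R) (b : 'rV[R]_n) : al != 0 ->
  \det (al%:M + be *: (b^T *m b)) = al ^+ n * (1 + be / al * \sum_k b 0 k ^+ 2).
Proof.
move=> al0; pose c := - be *: b^T.
have E1 : block_mx 1%:M b c al%:M = block_mx 1%:M 0 c 1%:M *m
    block_mx 1%:M b 0 (al%:M - c *m b) :> 'M[R]_(1 + n).
  rewrite mulmx_block ?mul1mx ?mul0mx ?mulmx0 ?mulmx1 ?addr0.
  by rewrite addrC subrK.
have E2 : block_mx 1%:M b c al%:M = block_mx 1%:M (al^-1 *: b) 0 1%:M *m
    block_mx (1%:M - al^-1 *: (b *m c)) 0 c al%:M :> 'M[R]_(1 + n).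
  rewrite mulmx_block ?mul1mx ?mul0mx ?mulmx0 ?mulmx1 ?addr0 ?add0r.
  by rewrite -scalemxAl subrK -scalemxAl mul_mx_scalar scalerA mulVf// scale1r.
have := congr1 determinant E1; rewrite E2 !det_mulmx !(@det_ublock _ 1 n) !(@det_lblock _ 1 n).
rewrite !det1 !mul1r det_scalar => H.
rewrite -scalemxAl scaleNr opprK in H; rewrite -H mulrC; congr (_ * _).
have -> : b *m c = (- be * \sum_k b 0 k ^+ 2)%:M.
  by rewrite -scalemxAr [b *m b^T]mx11_scalar mul_tr_self scale_scalar_mx.
by rewrite scale_scalar_mx -raddfB/= det_scalar1; ring.
Qed.

Lemma bernoulli_sub (s : R) k : 0 <= s <= 1 -> 1 - k%:R * s <= (1 - s) ^+ k.
Proof.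
move=> /andP[s0 s1]; elim: k => [|k IH]; first by rewrite mul0r subr0 expr0.
rewrite exprS; apply: le_trans (_ : (1 - s) * (1 - k%:R * s) <= _).
  rewrite -natr1; have : 0 <= k%:R * s ^+ 2 by rewrite mulr_ge0// sqr_ge0.
  by rewrite expr2; lra.
by rewrite ler_wpM2l// subr_ge0.
Qed.

(** At s = 0 the determinant is 1 and its derivative is n (|b|^2 - 1), which therefore cannot be
    positive. *)
Lemma dual_norm_le1 n (b : 'rV[R]_n) : (0 < n)%N ->
  (forall s, 0 < s < 1 -> \det ((1 - s)%:M + (s * n%:R) *: (b^T *m b)) <= 1) ->
  \sum_k b 0 k ^+ 2 <= 1.
Proof.
move=> n0 H; set q := \sum_k _; rewrite leNgt; apply/negP => q1.
have N1 : 1 <= n%:R :> R by rewrite ler1n.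
(* With this s the second order loss is at most half of the first order gain n (q - 1) s. *)
pose s := (q - 1) / (2 * n%:R * q).
have den : 0 < 2 * n%:R * q by nra.
have s0 : 0 < s by rewrite divr_gt0// subr_gt0.
have sE : s * (2 * n%:R * q) = q - 1 by rewrite divfK// gt_eqF.
have s1 : s < 1 by rewrite ltr_pdivrMr// mul1r; nra.
have /H : 0 < s < 1 by rewrite s0.
rewrite det_rank1_update; last by rewrite subr_eq0 gt_eqF.
rewrite -/q -(prednK n0) exprS prednK//.
have -> (x : R) : (1 - s) * x * (1 + s * n%:R / (1 - s) * q) = x * (1 - s + s * n%:R * q).
  by field; rewrite subr_eq0 gt_eqF.
apply/negP; rewrite -ltNge.
have ub : 0 < 1 - s + s * n%:R * q by nra.
have : 1 - n.-1%:R * s <= (1 - s) ^+ n.-1 by apply: bernoulli_sub; rewrite !ltW.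
rewrite -(ler_pM2r ub); apply: lt_le_trans.
have -> : n.-1%:R = n%:R - 1 :> R by rewrite -subn1 natrB.
move: (n%:R : R) N1 sE {H s1 ub den} => N N1 sE.
have h1 : (N - 1) * (N * q - 1) <= N * N * q by nra.
have h2 : s * ((N - 1) * (N * q - 1)) <= s * (N * N * q) by rewrite ler_pM2l.
have h3 : s * (N * N * q) = N * (q - 1) / 2 by rewrite -sE; field.
have h4 : 0 < N * (q - 1) by rewrite mulr_gt0; lra.
have h5 : 0 < s * (N * (q - 1) - s * ((N - 1) * (N * q - 1))) by rewrite mulr_gt0//; lra.
have -> : (1 - (N - 1) * s) * (1 - s + s * N * q) =
  1 + s * (N * (q - 1) - s * ((N - 1) * (N * q - 1))) by ring.
by rewrite ltrDl.
Qed.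

End QuadraticForms.

(** The rows of [U], multiplied by the transpose of [invmx N] and weighted by n p_i, form a tight
    frame of total weight n. *)
Lemma slabs_volume_le_gram {R : realType} m n (U : 'M[R]_(m, n)) (p : 'I_m -> R) (N : 'M[R]_n) :
  (forall i, 0 <= p i) -> \sum_i p i = 1 -> N \in unitmx ->
  N *m N^T = n%:R *: gram U (\row_i p i) ->
  (`|\det N|%:E * volume (slabs U) <= (2 ^+ n)%:E)%E.
Proof.
move=> p0 p1 uN NN.
pose V := invmx N; pose U' := U *m V^T.
have NV : N *m V = 1%:M by exact: mulmxV.
have VN : V *m N = 1%:M by exact: mulVmx.
have tight : gram U' (\row_i (n%:R * p i)) = 1%:M.
  have -> : \row_i (n%:R * p i) = n%:R *: \row_i p i by apply/rowP => i; rewrite !mxE.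
  rewrite /gram linearZ/= -scalemxAr -scalemxAl /U' trmx_mul trmxK.
  have -> : n%:R *: (V *m U^T *m diag_mx (\row_i p i) *m (U *m V^T)) =
     V *m (n%:R *: gram U (\row_i p i)) *m V^T.
    by rewrite /gram -scalemxAr -scalemxAl !mulmxA.
  by rewrite -NN !mulmxA VN mul1mx -trmx_mul VN trmx1.
have := slabs_volume_le (fun i => mulr_ge0 (ler0n R n) (p0 i)) tight.
rewrite -mulr_sumr p1 mulr1 => /(_ erefl).
have -> : slabs U' = [set v | slabs U (v *m V + 0)].
  have E v i : dot U' v i = dot U (v *m V + 0) i.
    have dE (W : 'M[R]_(m, n)) x : dot W x i = (x *m W^T) 0 i.
      by rewrite mxE; apply: eq_bigr => k _; rewrite mxE.
    by rewrite !dE /U' trmx_mul trmxK mulmxA addr0.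
  by apply/seteqP; split => v /= h i; have := h i; rewrite E.
rewrite volume_affine; [|by rewrite unitmx_inv|exact: vmeasurable_slabs].
by rewrite det_inv normrV ?invrK// unitfE -unitmxE.
Qed.

(** * Symmetric bodies and optimal designs *)

Section ContinuousFunctions.
Context {R : realType}.

Lemma continuous_sum (T : topologicalType) (I : finType) (f : I -> T -> R) :
  (forall i, continuous (f i)) -> continuous (fun x => \sum_i f i x).
Proof.
move=> cf; apply: (@continuous_big R^o I +%R 0 xpredT _ T (index_enum I) f) => //.
exact: add_continuous.
Qed.

Lemma continuous_prod (T : topologicalType) (I : finType) (f : I -> T -> R) :
  (forall i, continuous (f i)) -> continuous (fun x => \prod_i f i x).
Proof.
move=> cf; apply: (@continuous_big R I *%R 1 xpredT _ T (index_enum I) f) => //.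
exact: mul_continuous.
Qed.

Lemma continuous_mull (T : topologicalType) (k : R) (f : T -> R) :
  continuous f -> continuous (fun x => k * f x).
Proof. by move=> cf x; apply: cvgMl_tmp; exact: cf. Qed.

Lemma continuous_add_cst (T : topologicalType) (k : R) (f : T -> R) :
  continuous f -> continuous (fun x => k + f x).
Proof. by move=> cf x; apply: cvgD; [exact: cvg_cst|exact: cf]. Qed.

End ContinuousFunctions.

Section SymmetricBody.
Context {R : realType} {n : nat}.
Variable C : set 'rV[R]_n.
Hypotheses (C_body : convex_body C) (C_sym : symmetric_body C).

Definition inner (x a : 'rV[R]_n) : R := \sum_k x 0 k * a 0 k.

Definition polar : set 'rV[R]_n := [set a | forall x, C x -> `|inner x a| <= 1].

Lemma bodyN x : C x -> C (- x).
Proof. by move=> Cx; rewrite C_sym; exists x. Qed.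

Lemma body_conv x y t : 0 <= t <= 1 -> C x -> C y -> C (t *: x + (1 - t) *: y).
Proof.
have [_ cvx _] := C_body.
move=> /andP[t0 t1] Cx Cy; have t01 : Itv.spec (Itv.num_sem (R := R)) (Itv.Real `[0%Z, 1%Z]) t.
  by apply/and3P; split => //=; rewrite ?num_real.
have := cvx x y (Itv.mk t01); rewrite !inE => /(_ Cx Cy).
by [].
Qed.

(** By symmetry and convexity, a neighbourhood of an interior point x0 is recentred at 0 by
    averaging with - x0. *)
Lemma body_contains_box : exists2 d, 0 < d & forall z : 'rV[R]_n, (forall k, `|z 0 k| <= d) -> C z.
Proof.
have [_ _ [x0 /nbhs_ballP[e /= e0 eC]]] := C_body.
exists (e / 4); first by rewrite divr_gt0.
move=> z zd; have -> : z = (1/2) *: (x0 + 2 *: z) + (1 - 1/2) *: (- x0).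
  by apply/rowP => k; rewrite !mxE; field.
apply: body_conv; first by lra.
  apply: eC; split => // i j; rewrite (ord1 i) /ball/= !mxE opprD addNKr normrN normrM ger0_norm//.
  by have := zd j; lra.
apply: bodyN; apply: eC; exact: ballxx.
Qed.

Lemma body_bounded : exists2 B, 0 < B & forall x, C x -> forall k, `|x 0 k| <= B.
Proof.
have [/compact_bounded [M [Mreal CM]] _ _] := C_body.
exists (`|M| + 1); first by rewrite ltr_pwDr.
move=> x Cx k; apply: le_trans (CM (`|M| + 1) _ x Cx); last first.
  by rewrite (le_lt_trans (ler_norm _))// ltrDl.
rewrite [leRHS]/Num.norm/= mx_normrE.
exact: (le_bigmax _ (fun ij => `|x ij.1 ij.2|) (0, k)).
Qed.

(** Separation at the point p of C nearest to x: w = x - p attains its maximum over C at p, and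
    symmetry makes the bound two-sided. Dividing w by [th], strictly between <p, w> and <x, w>, puts
    it in the polar. *)
Lemma bipolar x : ~ C x -> exists2 a, polar a & 1 < inner x a.
Proof.
move=> nCx.
have [d d0 dC] := body_contains_box.
have C0 : C 0 by apply: dC => k; rewrite mxE normr0 ltW.
pose f (y : 'rV[R]_n) := \sum_k (x 0 k - y 0 k) ^+ 2.
have cf : continuous f.
  apply: continuous_sum => k y.
  apply: (@continuous_comp _ _ _ (fun y : 'rV[R]_n => x 0 k - y 0 k) (fun t => t ^+ 2)).
    by apply: continuousB; [exact: cst_continuous|exact: coord_continuous].
  exact: exprn_continuous.
have [cC _ _] := C_body.
have [p] : exists2 p, p \in C & forall t, t \in C -> f p <= f t.
  by apply: EVT_min_rV => //; [exists 0|exact: continuous_subspaceT].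
rewrite inE => Cp pmin.
pose w := x - p; pose q := \sum_k w 0 k ^+ 2.
have fw : f p = q by apply: eq_bigr => k _; rewrite !mxE.
have q0 : 0 < q.
  rewrite lt_neqAle sumr_ge0 ?andbT; last by move=> k _; exact: sqr_ge0.
  apply/negP => /eqP/esym/eqP; rewrite psumr_eq0; last by move=> k _; exact: sqr_ge0.
  move=> /allP h; apply: nCx; suff -> : x = p by [].
  apply/rowP => k; apply/eqP; rewrite -subr_eq0 -sqrf_eq0.
  by have := h k (mem_index_enum _); rewrite !mxE.
have ipw y : C y -> inner y w <= inner p w.
  move=> Cy; rewrite leNgt; apply/negP => lt.
  pose e := inner y w - inner p w.
  have e0 : 0 < e by rewrite subr_gt0.
  pose Q := \sum_k (y 0 k - p 0 k) ^+ 2.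
  have Q0 : 0 <= Q by apply: sumr_ge0 => k _; exact: sqr_ge0.
  (* Moving from p towards y by t changes the squared distance to x by -2 t e + t^2 Q, negative for
     this t. *)
  pose t := e / (e + Q).
  have eQ : 0 < e + Q by rewrite ltr_wpDr.
  have t0 : 0 < t by rewrite divr_gt0.
  have t1 : t <= 1 by rewrite ler_pdivrMr// mul1r lerDl.
  have tE : t * (e + Q) = e by rewrite divfK// gt_eqF.
  have : f p <= f (t *: y + (1 - t) *: p).
    by apply: pmin; rewrite inE; apply: body_conv => //; rewrite (ltW t0).
  rewrite fw; have -> : f (t *: y + (1 - t) *: p) = q - 2 * t * e + t ^+ 2 * Q.
    rewrite /f /q /e /Q /inner -sumrB !mulr_sumr -sumrB -big_split/=.
    by apply: eq_bigr => k _; rewrite !mxE; ring.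
  by apply/negP; rewrite -ltNge; nra.
have h0 : 0 <= inner p w.
  have := ipw _ C0; suff -> : inner 0 w = 0 by [].
  by rewrite /inner big1// => k _; rewrite mxE mul0r.
have xw : inner x w = inner p w + q.
  rewrite /inner /q -big_split/=; apply: eq_bigr => k _; rewrite !mxE; ring.
pose th := inner p w + q / 2.
have th0 : 0 < th by rewrite ltr_wpDl// divr_gt0.
have ipZ y : inner y (th^-1 *: w) = inner y w / th.
  by rewrite /inner mulr_suml; apply: eq_bigr => k _; rewrite !mxE; ring.
have ipN y : inner (- y) w = - inner y w.
  by rewrite /inner -sumrN; apply: eq_bigr => k _; rewrite !mxE mulNr.
exists (th^-1 *: w); last by rewrite ipZ ltr_pdivlMr// mul1r xw /th; lra.
move=> y Cy; rewrite ipZ normrM [X in _ * X]gtr0_norm ?invr_gt0// ler_pdivrMr// mul1r.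
have := ipw _ Cy; have := ipw _ (bodyN Cy); rewrite ipN /th => ? ?.
by rewrite ler_norml; apply/andP; split; lra.
Qed.

End SymmetricBody.

Section OptimalDesign.
Context {R : realType} {n : nat}.
Hypothesis n_gt0 : (0 < n)%N.
Variable C : set 'rV[R]_n.
Hypotheses (C_body : convex_body C) (C_sym : symmetric_body C).

(** No bound on m is imposed, so that [design_mix] just adds a point; compactness comes from the
    closure taken in [optimal_design]. *)
Definition designs : set 'M[R]_n := [set M | exists m (U : 'M[R]_(m, n)) (p : 'I_m -> R),
  [/\ forall i, 0 <= p i, \sum_i p i = 1, forall i, polar C (row i U) &
      M = gram U (\row_i p i)]].

Lemma design_mix M a s : designs M -> polar C a -> 0 <= s <= 1 ->
  designs ((1 - s) *: M + s *: (a^T *m a)).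
Proof.
move=> [m [U [p [p0 p1 pU ->]]]] pa /andP[s0 s1].
exists (m + 1)%N, (col_mx U a), (fun i => match fintype.split i with inl j => (1 - s) * p j | inr _ => s end).
have s1' : 0 <= 1 - s by rewrite subr_ge0.
have spl (j : 'I_m) : fintype.split (lshift 1 j) = inl j by exact: (unsplitK (inl j)).
have spr (j : 'I_1) : fintype.split (rshift m j) = inr j by exact: (unsplitK (inr j)).
split.
- by move=> i; case: (fintype.split i) => // j; rewrite mulr_ge0.
- rewrite big_split_ord/= big_ord1 spr.
  by under eq_bigr do rewrite spl; rewrite -mulr_sumr p1 mulr1 subrK.
- move=> i; rewrite -(splitK i); case: (fintype.split i) => j /=.
    rewrite (_ : row _ _ = row j U)//.
    by apply/rowP => k; rewrite mxE col_mxEu mxE.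
  rewrite (_ : row _ _ = a)//.
  by apply/rowP => k; rewrite mxE col_mxEd ord1.
apply/matrixP => j k; rewrite [RHS]gramE big_split_ord/= big_ord1.
rewrite [LHS]mxE [X in X + _]mxE [X in _ + X]mxE gramE; congr (_ + _).
  rewrite mulr_sumr; apply: eq_bigr => i _; rewrite !col_mxEu !mxE spl; ring.
by rewrite !col_mxEd !mxE big_ord1 !mxE spr mulrA.
Qed.

Lemma design_sym M : designs M -> M^T = M.
Proof.
move=> [m [U [p [_ _ _ ->]]]].
by rewrite /gram !trmx_mul trmxK tr_diag_mx mulmxA.
Qed.

Lemma gram_form m (U : 'M[R]_(m, n)) w (x : 'rV[R]_n) :
  (x *m gram U w *m x^T) 0 0 = \sum_i w 0 i * dot U x i ^+ 2.
Proof.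
rewrite mxE; under eq_bigr do rewrite mul_gram mulr_suml.
rewrite exchange_big/=; apply: eq_bigr => i _.
rewrite expr2 mulrA [X in _ = _ * X]/dot mulr_sumr.
by apply: eq_bigr => k _; rewrite mxE; ring.
Qed.

Lemma design_psd M : designs M -> forall x : 'rV[R]_n, 0 <= (x *m M *m x^T) 0 0.
Proof.
move=> [m [U [p [p0 _ _ ->]]]] x; rewrite gram_form.
by apply: sumr_ge0 => i _; rewrite mxE mulr_ge0// sqr_ge0.
Qed.

Lemma polar_bounded : exists2 B, 0 <= B & forall a, polar C a -> forall k, `|a 0 k| <= B.
Proof.
have [d d0 dC] := body_contains_box C_body C_sym.
exists d^-1; first by rewrite invr_ge0 ltW.
move=> a pa k; have := pa (d *: delta_mx 0 k).
have -> : inner (d *: delta_mx 0 k) a = d * a 0 k.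
  rewrite /inner (bigD1 k)//= big1 => [|i ik].
    by rewrite !mxE !eqxx addr0 mulr1.
  by rewrite !mxE (negbTE ik) andbF mulr0 mul0r.
rewrite normrM gtr0_norm// -ler_pdivlMl// mulr1; apply; apply: dC => i.
by rewrite !mxE eqxx/=; case: eqVneq => _; rewrite ?mulr1 ?mulr0 ?normr0 ?gtr0_norm// ltW.
Qed.

Lemma design_bounded : exists B, forall M, designs M -> forall j k, `|M j k| <= B.
Proof.
have [B B0 pB] := polar_bounded.
exists (B * B) => M [m [U [p [p0 p1 pU ->]]]] j k.
rewrite gramE; apply: le_trans (ler_norm_sum _ _ _) _.
rewrite -[leRHS]mul1r -p1 mulr_suml; apply: ler_sum => i _.
rewrite mxE !normrM ger0_norm// -mulrA ler_wpM2l//.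
have := pB _ (pU i) j; have := pB _ (pU i) k; rewrite !mxE => ? ?.
exact: ler_pM.
Qed.

(** Basis vectors shrunk into the polar give a nondegenerate design, so the maximal determinant is
    positive. *)
Lemma design_scalar : exists2 d, 0 < d & designs d%:M.
Proof.
have [B B0 CB] := body_bounded C_body.
have n0 : 0 < n%:R :> R by rewrite ltr0n.
exists (n%:R^-1 * B^-1 ^+ 2); first by rewrite mulr_gt0 ?exprn_gt0 ?invr_gt0.
exists n, (B^-1)%:M, (fun=> n%:R^-1); split.
- by move=> _; rewrite invr_ge0 ltW.
- by rewrite sumr_const card_ord -[LHS]mulr_natr mulVf// gt_eqF.
- move=> i x Cx; have -> : inner x (row i (B^-1)%:M) = B^-1 * x 0 i.
    rewrite /inner (bigD1 i)//= big1 => [|j ji].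
      by rewrite !mxE eqxx addr0 mulr1n mulrC.
    by rewrite !mxE eq_sym (negbTE ji) mulr0n mulr0.
  rewrite normrM gtr0_norm ?invr_gt0// -ler_pdivlMl ?invr_gt0// invrK mulr1.
  exact: CB.
apply/matrixP => j k; rewrite gramE (bigD1 j)//= big1 => [|i ij].
  by rewrite !mxE eqxx addr0; case: (j == k); rewrite ?mulr1n ?mulr0n ?mulr0 //; ring.
by rewrite !mxE (negbTE ij) mulr0n mulr0 mul0r.
Qed.

Lemma continuous_det_vec N (h : 'rV[R]_N -> 'M[R]_n) :
  (forall i j, continuous (fun v => h v i j)) -> continuous (fun v => \det (h v)).
Proof.
move=> ch; rewrite /determinant.
apply: continuous_sum => s; apply: continuous_mull; apply: continuous_prod => i.
exact: ch.
Qed.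

Lemma closure_le_const (T : topologicalType) (S : set T) (f : T -> R) b :
  continuous f -> (forall v, S v -> f v <= b) -> forall v, closure S v -> f v <= b.
Proof.
move=> cf Sb v clv; rewrite leNgt; apply/negP => bf.
have : nbhs v (f @^-1` [set t | b < t]).
  by apply: cf; exact: open_nbhs_nbhs (conj (@open_gt _ b) bf).
by move=> /clv [w [Sw /=]]; rewrite ltNge Sb.
Qed.

(** The maximizer lies in the closure of the designs and comes with no frame. Its properties are
    closed conditions passing to the limit, apart from positivity of the determinant, which comes
    from comparison with [design_scalar]. The last clause carries over bounds proved for genuine
    designs. *)
Theorem optimal_design : exists M : 'M[R]_n,
  [/\ M^T = M, forall x : 'rV[R]_n, 0 <= (x *m M *m x^T) 0 0, 0 < \det M,
      forall a s, polar C a -> 0 <= s <= 1 ->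
        \det ((1 - s) *: M + s *: (a^T *m a)) <= \det M &
      forall b, (forall M', designs M' -> \det M' <= b) -> \det M <= b].
Proof.
pose S := [set v : 'rV[R]_(n * n) | designs (vec_mx v)].
have ccoord i j : continuous (fun v : 'rV[R]_(n * n) => vec_mx v i j).
  move=> v; under eq_fun do rewrite mxE.
  exact: coord_continuous.
have cdet : continuous (fun v : 'rV[R]_(n * n) => \det (vec_mx v)).
  by apply: continuous_det_vec => i j; exact: ccoord.
have [B SB] := design_bounded.
have clB v : closure S v -> forall i j, `|vec_mx v i j| <= B.
  move=> clv i j; apply: (closure_le_const (S := S) (f := fun v => `|vec_mx v i j|)) => //.
    move=> u; apply: (@continuous_comp _ _ _ (fun v : 'rV[R]_(n * n) => vec_mx v i j)).
      exact: ccoord.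
    exact: norm_continuous.
  by move=> u Su; exact: SB.
have compK : compact (closure S).
  apply: bounded_closed_compact; last exact: closed_closure.
  exists B; split; first exact: num_real.
  move=> b Bb v clv.
  have b0 : 0 <= b.
    by apply: le_trans (ltW Bb); have := clB _ clv (Ordinal n_gt0) (Ordinal n_gt0); exact: le_trans.
  rewrite /= [leLHS]/Num.norm/= mx_normrE; apply/bigmax_leP; split => // -[i k] _ /=.
  rewrite (ord1 i); case/mxvec_indexP: k => j k.
  by have := clB _ clv j k; rewrite mxE => h; exact: le_trans h (ltW Bb).
have [d d0 Dd] := design_scalar.
have Sd : S (mxvec d%:M) by rewrite /S /= mxvecK.
have subK v : S v -> closure S v by move=> Sv; exact: subset_closure.
have [v] : exists2 v, v \in closure S & forall t, t \in closure S -> \det (vec_mx t) <= \det (vec_mx v).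
  apply: EVT_max_rV => //; first by exists (mxvec d%:M); exact: subK.
  exact: continuous_subspaceT.
rewrite inE => clv vmax.
exists (vec_mx v); split.
- apply/matrixP => i j; rewrite mxE.
  apply/eqP; rewrite eq_le -subr_le0 -[X in _ && X]subr_le0; apply/andP; split.
    apply: (closure_le_const (S := S) (f := fun v => vec_mx v j i - vec_mx v i j)) => //.
      by move=> u; apply: continuousB; exact: ccoord.
    by move=> u Su; rewrite -[in X in X - _](design_sym Su) [X in X - _]mxE subrr.
  apply: (closure_le_const (S := S) (f := fun v => vec_mx v i j - vec_mx v j i)) => //.
    by move=> u; apply: continuousB; exact: ccoord.
  by move=> u Su; rewrite -[in X in X - _](design_sym Su) [X in X - _]mxE subrr.
- move=> x; rewrite -oppr_le0.
  apply: (closure_le_const (S := S) (f := fun v => - (x *m vec_mx v *m x^T) 0 0)) => //.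
    have -> : (fun v => - (x *m vec_mx v *m x^T) 0 0) =
        (fun v : 'rV[R]_(n * n) => \sum_k \sum_j (- (x 0 j * x 0 k)) * vec_mx v j k).
      apply/funext => u; rewrite mxE -sumrN; apply: eq_bigr => k _.
      rewrite mxE mulr_suml -sumrN; apply: eq_bigr => j _; rewrite [x^T _ _]mxE; ring.
    apply: continuous_sum => k; apply: continuous_sum => j.
    by apply: continuous_mull; exact: ccoord.
  by move=> u Su; rewrite oppr_le0; exact: design_psd.
- apply: lt_le_trans (vmax (mxvec d%:M) _); last by rewrite inE; exact: subK.
  by rewrite mxvecK det_scalar exprn_gt0.
- move=> a s pa s01.
  pose h (u : 'rV[R]_(n * n)) : 'M[R]_n := (1 - s) *: vec_mx u + s *: (a^T *m a).
  apply: (closure_le_const (S := S) (f := fun u => \det (h u))) => //.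
    apply: continuous_det_vec => i j.
    have -> : (fun u => h u i j) =
        (fun u => (s *: (a^T *m a)) i j + (1 - s) * vec_mx u i j).
      by apply/funext => u; rewrite addrC /h mxE [in LHS]mxE.
    by apply: continuous_add_cst; apply: continuous_mull; exact: ccoord.
  move=> u Su; have := vmax (mxvec (h u)); rewrite mxvecK inE; apply; apply: subK.
  by rewrite /S/= mxvecK; exact: design_mix.
move=> b Hb; apply: (closure_le_const (S := S) (f := fun u => \det (vec_mx u))) => //.
by move=> u Su; exact: Hb.
Qed.

End OptimalDesign.

(** * The position containing the unit ball *)

Section Position.
Context {R : realType} {n : nat}.
Hypothesis n_gt0 : (0 < n)%N.
Variable C : set 'rV[R]_n.
Hypotheses (C_body : convex_body C) (C_sym : symmetric_body C).

Lemma vmeasurable_body : vmeasurable C.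
Proof. by have [cC _ _] := C_body; exact: vmeasurable_compact. Qed.

Lemma volume_body_fin : volume C \is a fin_num.
Proof.
have [B B0 CB] := body_bounded C_body.
rewrite ge0_fin_numE ?volume_ge0//.
have sub : C `<=` box (const_mx (- B)) (const_mx B).
  by move=> x Cx i; rewrite !mxE -ler_norml; exact: CB.
apply: le_lt_trans (le_volume vmeasurable_body (vmeasurable_box _ _) sub) _.
by rewrite volume_box ?ltry// => i; rewrite !mxE; lra.
Qed.

Lemma det_sqr (N M : 'M[R]_n) : N *m N^T = n%:R *: M -> \det N ^+ 2 = n%:R ^+ n * \det M.
Proof. by move=> /(congr1 determinant); rewrite det_mulmx det_tr detZ expr2. Qed.

Lemma psd_cholesky (M : 'M[R]_n) : M^T = M ->
  (forall x : 'rV[R]_n, 0 <= (x *m M *m x^T) 0 0) -> 0 < \det M ->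
  exists2 N : 'M[R]_n, N \in unitmx & N *m N^T = n%:R *: M.
Proof.
move=> MT psd dM; have n0 : 0 < n%:R :> R by rewrite ltr0n.
have [N NN] : exists N : 'M[R]_n, N *m N^T = n%:R *: M.
  apply: cholesky; apply: psd_unit_posdef.
  - by rewrite linearZ/= MT.
  - by move=> x; rewrite -scalemxAr -scalemxAl mxE; apply: mulr_ge0; [exact: ltW|exact: psd].
  - by rewrite unitmxE detZ unitfE mulf_neq0 ?expf_neq0 ?gt_eqF.
exists N => //; rewrite unitmxE unitfE -sqrf_eq0 (det_sqr NN).
by rewrite mulf_neq0 ?expf_neq0 ?gt_eqF.
Qed.

(** C lies in the slabs of the design. Squaring eliminates N, leaving a bound on [\det M] alone, fit
    for the last clause of [optimal_design]. *)
Lemma design_volume M : designs C M -> 0 < \det M ->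
  n%:R ^+ n * \det M * fine (volume C) ^+ 2 <= 4 ^+ n.
Proof.
move=> DM dM; have [N uN NN] := psd_cholesky (design_sym DM) (design_psd DM) dM.
have [m [U [p [p0 p1 pU ME]]]] := DM; rewrite ME in NN.
have sub : C `<=` slabs U.
  move=> x Cx i; have := pU i x Cx; congr (`|_| <= 1).
  by apply: eq_bigr => k _; rewrite [row i U _ _]mxE.
have := slabs_volume_le_gram p0 p1 uN NN.
have := le_volume vmeasurable_body (vmeasurable_slabs U) sub.
have v0 : 0 <= fine (volume C) by rewrite fine_ge0// volume_ge0.
move=> h1 h2.
have {h1 h2} : (`|\det N|%:E * volume C <= (2 ^+ n)%:E)%E.
  apply: le_trans h2; rewrite lee_pmul2l//.
  by rewrite lte_fin normr_gt0 -unitfE -unitmxE.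
rewrite -(fineK volume_body_fin) -EFinM lee_fin => h.
rewrite -ME in NN; rewrite -(det_sqr NN) -[\det N ^+ 2](real_normK (num_real _)) -exprMn.
have -> : (4 : R) = 2 ^+ 2 by ring.
by rewrite exprAC lerXn2r// nnegrE ?mulr_ge0 ?exprn_ge0.
Qed.

Theorem ball_position : exists2 N : 'M[R]_n, N \in unitmx &
  let D := [set x *m N | x in C] in
  (forall y : 'rV[R]_n, \sum_k y 0 k ^+ 2 <= 1 -> D y) /\ (volume D <= (2 ^+ n)%:E)%E.
Proof.
have [M [MT psd dM Mopt Mvol]] := optimal_design n_gt0 C_body C_sym.
have [N uN NN] := psd_cholesky MT psd dM.
have n0 : 0 < n%:R :> R by rewrite ltr0n.
have NV : N *m invmx N = 1%:M by exact: mulmxV.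
have VN : invmx N *m N = 1%:M by exact: mulVmx.
exists N => //= ; split.
  move=> y y1; exists (y *m invmx N); last by rewrite -mulmxA VN mulmx1.
  apply: contrapT => /(bipolar C_body C_sym)[a pa].
  apply/negP; rewrite -leNgt.
  (* Conjugation by N turns the maximality of M against mixtures with a into the hypothesis of
     [dual_norm_le1] for b, and the pairing of [y *m invmx N] with a into <y, b>. *)
  pose b := a *m (invmx N)^T.
  have b1 : \sum_k b 0 k ^+ 2 <= 1.
    apply: dual_norm_le1 => // s /andP[s0 s1].
    have dN : 0 < \det N ^+ 2.
      by rewrite (det_sqr NN) mulr_gt0// exprn_gt0.
    rewrite -(ler_pM2l dN) mulr1.
    have -> (X : R) : \det N ^+ 2 * X = \det N * X * \det N^T by rewrite det_tr; ring.
    rewrite -!det_mulmx.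
    have -> : N *m ((1 - s)%:M + (s * n%:R) *: (b^T *m b)) *m N^T =
        n%:R *: ((1 - s) *: M + s *: (a^T *m a)).
      rewrite mulmxDr mulmxDl mul_mx_scalar -scalemxAl NN.
      rewrite -scalemxAr -scalemxAl /b trmx_mul trmxK !mulmxA NV mul1mx.
      rewrite -[a^T *m a *m _ *m _]mulmxA -trmx_mul NV trmx1 mulmx1.
      by rewrite scalerDr !scalerA [n%:R * _]mulrC [n%:R * _]mulrC.
    rewrite detZ (det_sqr NN) ler_pM2l ?exprn_gt0//; apply: Mopt => //.
    by rewrite !ltW.
  have -> : inner (y *m invmx N) a = \sum_k y 0 k * b 0 k.
    have -> : inner (y *m invmx N) a = (y *m invmx N *m a^T) 0 0.
      by rewrite [RHS]mxE; apply: eq_bigr => k _; rewrite [a^T _ _]mxE.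
    have -> : y *m invmx N *m a^T = y *m b^T by rewrite /b trmx_mul trmxK mulmxA.
    by rewrite [LHS]mxE; apply: eq_bigr => k _; rewrite [b^T _ _]mxE.
  have : 0 <= \sum_k (y 0 k - b 0 k) ^+ 2 by apply: sumr_ge0 => k _; exact: sqr_ge0.
  have -> : \sum_k (y 0 k - b 0 k) ^+ 2 =
      \sum_k y 0 k ^+ 2 + \sum_k b 0 k ^+ 2 + (- 2) * \sum_k y 0 k * b 0 k.
    by rewrite mulr_sumr -!big_split/=; apply: eq_bigr => k _; ring.
  lra.
have -> : [set x *m N | x in C] = [set y | C (y *m invmx N + 0)].
  apply/seteqP; split => y /=.
    by move=> [x Cx <-]; rewrite addr0 -mulmxA NV mulmx1.
  by rewrite addr0 => Cy; exists (y *m invmx N) => //; rewrite -mulmxA VN mulmx1.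
rewrite volume_affine ?unitmx_inv//; last exact: vmeasurable_body.
rewrite det_inv normrV ?invrK -?unitmxE// -(fineK volume_body_fin) -EFinM lee_fin.
set v := fine _; have v0 : 0 <= v by rewrite fine_ge0// volume_ge0.
have [->|vn0] := eqVneq v 0; first by rewrite mulr0 exprn_ge0.
have vgt0 : 0 < v by rewrite lt_neqAle eq_sym vn0.
have nv : 0 < n%:R ^+ n * v ^+ 2 by rewrite mulr_gt0 ?exprn_gt0.
(* [Mvol] transfers to M a bound valid for all designs; it is trivial for those of nonpositive
   determinant. *)
have : \det M <= 4 ^+ n / (n%:R ^+ n * v ^+ 2).
  apply: Mvol => M' DM'; rewrite ler_pdivlMr//.
  have [dM'|dM'] := leP (\det M') 0.
    by apply: le_trans (mulr_le0_ge0 dM' (ltW nv)) _; rewrite exprn_ge0.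
  by apply: le_trans (design_volume DM' dM'); rewrite le_eqVlt; apply/orP; left; apply/eqP; rewrite /v; ring.
rewrite ler_pdivlMr// => h.
rewrite -(@ler_pXn2r _ 2)// ?nnegrE ?mulr_ge0 ?exprn_ge0//.
rewrite exprMn real_normK ?num_real// (det_sqr NN).
have -> : (2 ^+ n) ^+ 2 = 4 ^+ n :> R by rewrite exprAC; congr (_ ^+ _); ring.
by apply: le_trans h; rewrite le_eqVlt; apply/orP; left; apply/eqP; ring.
Qed.

End Position.

(** * Surface area *)

Section SurfaceArea.
Context {R : realType}.

Lemma unit_ballP n (u : 'rV[R]_n) : euclidean_unit_ball u <-> \sum_k u 0 k ^+ 2 <= 1.
Proof.
rewrite /euclidean_unit_ball /euclidean_norm /= -[X in _ <= X]sqrtr1.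
by rewrite ler_sqrt.
Qed.

Lemma unit_ball_coord n (u : 'rV[R]_n) : euclidean_unit_ball u -> forall k, `|u 0 k| <= 1.
Proof.
move=> /unit_ballP u1 k; rewrite -(@expr_le1 _ 2)// real_normK ?num_real//.
apply: le_trans u1; rewrite (bigD1 k)//= lerDl.
by apply: sumr_ge0 => i _; exact: sqr_ge0.
Qed.

Lemma compact_box_subset n B (X : set 'rV[R]_n) : closed X ->
  (forall x, X x -> forall k, `|x 0 k| <= B) -> compact X.
Proof.
move=> cX XB; apply: bounded_closed_compact => //.
exists `|B|; split; first exact: num_real.
move=> b Bb x Xx; have b0 : 0 <= b by apply: le_trans (ltW Bb).
rewrite /= [leLHS]/Num.norm/= mx_normrE; apply/bigmax_leP; split => // -[i k] _ /=.
rewrite (ord1 i); apply: le_trans (XB _ Xx k) _.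
by apply: le_trans (ltW Bb); exact: ler_norm.
Qed.

Lemma compact_unit_ball n : compact (@euclidean_unit_ball R n).
Proof.
apply: (@compact_box_subset _ 1) => [|x]; last exact: unit_ball_coord.
have -> : @euclidean_unit_ball R n = (fun u : 'rV[R]_n => \sum_k u 0 k ^+ 2) @^-1` [set t | t <= 1].
  by apply/seteqP; split => u /unit_ballP.
apply: preimage_closed; last exact: closed_le.
move=> u _; move: u; apply: continuous_sum => k u.
apply: (@continuous_comp _ _ _ (fun y : 'rV[R]_n => y 0 k) (fun t => t ^+ 2)).
  exact: coord_continuous.
exact: exprn_continuous.
Qed.

Lemma compact_parallel_body n (K : set 'rV[R]_n) e : compact K -> compact (parallel_body K e).
Proof.
move=> cK.
have -> : parallel_body K e = (fun p : 'rV[R]_n * 'rV[R]_n => p.1 + e *: p.2) @`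
    (K `*` @euclidean_unit_ball R n).
  apply/seteqP; split => x.
    by move=> [k Kk] [u Bu] <-; exists (k, u).
  by move=> [[k u] [Kk Bu]] <-; exists k => //; exists u.
apply: continuous_compact; last exact: compact_setX cK (@compact_unit_ball n).
apply: continuous_subspaceT => p; apply: cvgD; first exact: cvg_fst.
by apply: cvgZl_tmp; exact: cvg_snd.
Qed.

Lemma compact_box n (l u : 'rV[R]_n) : compact (box l u).
Proof.
apply: (@compact_box_subset _ (\sum_k (`|l 0 k| + `|u 0 k|))).
  have -> : box l u = \bigcap_k [set v : 'rV[R]_n | l 0 k <= v 0 k <= u 0 k].
    by apply/seteqP; split => v /= h k => [_|]; exact: h.
  apply: closed_bigI => k _.
  have -> : [set v : 'rV[R]_n | l 0 k <= v 0 k <= u 0 k] =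
      (fun v : 'rV[R]_n => v 0 k) @^-1` `[l 0 k, u 0 k]%classic.
    by apply/seteqP; split => v /=; rewrite in_itv.
  apply: preimage_closed; last exact: interval_closed.
  by move=> v _; exact: coord_continuous.
move=> x h k; have /andP[h1 h2] := h k.
rewrite (bigD1 k)//=; apply: le_trans (_ : `|l 0 k| + `|u 0 k| <= _); last first.
  by rewrite lerDl; apply: sumr_ge0 => j _; exact: addr_ge0.
rewrite ler_norml; apply/andP; split.
  apply: le_trans h1; rewrite lerNl; apply: le_trans (ler_norm _) _.
  by rewrite normrN lerDl.
by apply: (le_trans h2); apply: le_trans (ler_norm _) _; rewrite lerDr.
Qed.

(** Only the linear term survives in the surface area; [4 ^+ k] is a convenient constant for the
    induction. *)
Lemma expr_quadratic_le (t : R) k : 0 <= t <= 1 ->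
  (1 + t) ^+ k <= 1 + k%:R * t + 4 ^+ k * t ^+ 2.
Proof.
move=> /andP[t0 t1]; elim: k => [|k IH].
  by rewrite !expr0 mul0r addr0 mul1r lerDl sqr_ge0.
rewrite exprS; apply: le_trans (_ : (1 + t) * (1 + k%:R * t + 4 ^+ k * t ^+ 2) <= _).
  by rewrite ler_wpM2l// addr_ge0.
have k4 : k%:R <= 4 ^+ k :> R.
  by rewrite -natrX ler_nat ltnW// ltn_expl.
have K0 : 0 <= 4 ^+ k :> R by exact: exprn_ge0.
have -> : 4 ^+ k.+1 = 4 * 4 ^+ k :> R by exact: exprS.
have -> : k.+1%:R = k%:R + 1 :> R by rewrite natr1.
move: (4 ^+ k : R) (k%:R : R) k4 K0 => K N k4 K0.
have Kt : K * t <= K by rewrite ler_piMr.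
have : 0 <= t ^+ 2 * (4 * K - N - K - K * t) by rewrite mulr_ge0 ?sqr_ge0//; lra.
rewrite !expr2; lra.
Qed.

Definition growth n (K : set 'rV[R]_n) (e : R) : \bar R :=
  ((volume (parallel_body K e) - volume K) * (e^-1)%:E)%E.

Lemma cvg_affine_at_right (a b : R) : (a + b * e)%:E @[e --> 0^'+] --> a%:E.
Proof.
apply: cvg_EFin; first by near=> e.
have : a + b * e @[e --> 0^'+] --> a + b * 0.
  apply: cvgD; first exact: cvg_cst.
  by apply: cvgMl_tmp; exact: cvg_at_right_filter.
by rewrite mulr0 addr0.
Unshelve. all: by end_near.
Qed.

(* Without a limit [surface_area K] is the default value 0, hence [0 <= a]. *)
Lemma surface_area_le n (K : set 'rV[R]_n) (a b : R) : 0 <= a ->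
  (\forall e \near 0^'+, (growth K e <= (a + b * e)%:E)%E) ->
  (surface_area K <= a%:E)%E.
Proof.
move=> a0 H; rewrite /surface_area.
have [cv|ncv] := pselect (cvg (growth K e @[e --> 0^'+])).
  exact: lee_cvg_to cv (@cvg_affine_at_right a b) H.
rewrite (dvgP ncv); rewrite lee_fin//.
Qed.

Lemma surface_area_eq n (K : set 'rV[R]_n) (a b : R) :
  (\forall e \near 0^'+, (a%:E <= growth K e <= (a + b * e)%:E)%E) ->
  surface_area K = a%:E.
Proof.
move=> H; apply/cvg_lim => //.
exact: (squeeze_cvge (f := fun=> a%:E) H (@cvg_cst _ _ _ _ _) (@cvg_affine_at_right a b)).
Qed.

Lemma growth_le n (K : set 'rV[R]_n) (v w e : R) : 0 < e -> volume K = v%:E ->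
  (volume (parallel_body K e) <= (v + w * e)%:E)%E -> (growth K e <= w%:E)%E.
Proof.
move=> e0 vK vP; rewrite /growth vK.
rewrite lee_pdivrMr// -EFinM leeBlDr// -EFinD addrC; exact: vP.
Qed.

Lemma growth_ge n (K : set 'rV[R]_n) (v w e : R) : 0 < e -> volume K = v%:E ->
  ((v + w * e)%:E <= volume (parallel_body K e))%E -> (w%:E <= growth K e)%E.
Proof.
move=> e0 vK vP; rewrite /growth vK.
by rewrite lee_pdivlMr// -EFinM leeBrDr// -EFinD addrC.
Qed.

End SurfaceArea.

(** * The surface area of the cube *)

Section Cube.
Context {R : realType}.
Local Notation mu := (@lebesgue_measure R).

Lemma parallel_body_sub n (K : set 'rV[R]_n) e : K `<=` parallel_body K e.
Proof.
move=> x Kx; exists x => //; exists 0; last by rewrite scaler0 addr0.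
by apply/unit_ballP; rewrite big1 // => k _; rewrite mxE expr0n.
Qed.

Lemma integral_indicZ (A : set R) (r : R) : measurable A -> 0 <= r ->
  (\int[mu]_x ((\1_A x)%:E * r%:E) = mu A * r%:E)%E.
Proof.
move=> mA r0; rewrite ge0_integralZr//.
  by rewrite integral_indic// setIT.
exact/measurable_EFinP/measurable_indic.
Qed.

(** The volume of the cube and of the prisms of height e on its 2n facets; the rest of the parallel
    body is of higher order in e. *)
Lemma volume_parallel_cube_ge n (s e : R) : 0 < s -> 0 < e ->
  ((s ^+ n + n%:R * s ^+ n.-1 * (2 * e))%:E <=
   volume (parallel_body (box (0 : 'rV[R]_n) (const_mx s)) e))%E.
Proof.
move=> s0 e0; elim: n => [|m IH].
  have mP : vmeasurable (parallel_body (box (0 : 'rV[R]_0) (const_mx s)) e).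
    by apply: vmeasurable_compact; apply: compact_parallel_body; exact: compact_box.
  apply: le_trans (le_volume (vmeasurable_box _ _) mP (@parallel_body_sub _ _ e)).
  by rewrite volume_box => [|[]//]; rewrite big_ord0 expr0 mul0r mul0r addr0.
pose P k := parallel_body (box (0 : 'rV[R]_k) (const_mx s)) e.
have mP : vmeasurable (P m.+1).
  by apply: vmeasurable_compact; apply: compact_parallel_body; exact: compact_box.
have mPm : vmeasurable (P m).
  by apply: vmeasurable_compact; apply: compact_parallel_body; exact: compact_box.
rewrite -/(P m.+1) -/(P m) in IH *.
pose sec (x : R) : set 'rV[R]_m := [set y | P m.+1 (row_mx x%:M y : 'rV[R]_(1 + m))].
have msec x : vmeasurable (sec x) by exact: (@vmeasurable_section _ m (P m.+1)).
have boxS (x : R) (y : 'rV[R]_m) : 0 <= x <= s -> box 0 (const_mx s) y ->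
    box (0 : 'rV[R]_m.+1) (const_mx s) (row_mx x%:M y : 'rV[R]_(1 + m)).
  move=> hx hy i; rewrite !mxE; case: splitP => j ij; first by rewrite (ord1 j) mxE eqxx.
  by have := hy j; rewrite !mxE.
have ballS (x : R) (y : 'rV[R]_m) : x ^+ 2 + \sum_k y 0 k ^+ 2 <= 1 ->
    euclidean_unit_ball (row_mx x%:M y : 'rV[R]_(1 + m)).
  move=> h; apply/unit_ballP; rewrite big_split_ord/= big_ord1 row_mxEl mxE eqxx mulr1n.
  by under eq_bigr do rewrite row_mxEr.
pose a := s ^+ m + m%:R * s ^+ m.-1 * (2 * e).
have a0 : 0 <= a by rewrite addr_ge0 ?exprn_ge0 ?mulr_ge0 ?exprn_ge0 ?(ltW s0) ?(ltW e0).
have b0 : 0 <= s ^+ m by rewrite exprn_ge0// ltW.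
(* The section at x contains a parallel body of the lower-dimensional cube if x is
   in [0, s], and that cube itself if x is within e of [0, s]. *)
have sec_mid x : 0 <= x <= s -> (a%:E <= volume (sec x))%E.
  move=> hx; apply: le_trans IH _; apply: le_volume => // _ [y By] [u /unit_ballP Bu] <-.
  exists (row_mx x%:M y : 'rV[R]_(1 + m)); first exact: boxS.
  exists (row_mx 0%:M u : 'rV[R]_(1 + m)); first by apply: ballS; rewrite expr0n/= add0r.
  rewrite (@scale_row_mx _ 1 1 m) (@add_row_mx _ 1 1 m).
  by rewrite raddf0 scaler0 addr0.
have sec_side x x0 : 0 <= x0 <= s -> `|x - x0| <= e -> ((s ^+ m)%:E <= volume (sec x))%E.
  move=> hx0 xe.
  have -> : s ^+ m = \prod_(i < m) ((const_mx s : 'rV[R]_m) 0 i - (0 : 'rV[R]_m) 0 i).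
    rewrite (eq_bigr (fun=> s)) => [|i _]; last by rewrite !mxE subr0.
    by rewrite prodr_const card_ord.
  rewrite -volume_box => [|i]; last by rewrite !mxE ltW.
  apply: le_volume => // [|y By]; first exact: vmeasurable_box.
  exists (row_mx x0%:M y : 'rV[R]_(1 + m)); first exact: boxS.
  exists (row_mx ((x - x0) / e)%:M 0 : 'rV[R]_(1 + m)).
    apply: ballS; rewrite big1 => [|k _]; last by rewrite mxE expr0n.
    rewrite addr0 -[_ ^+ 2](real_normK (num_real _)) expr_le1//.
    by rewrite normrM [X in _ * X]gtr0_norm ?invr_gt0// ler_pdivrMr// mul1r.
  rewrite (@scale_row_mx _ 1 1 m) (@add_row_mx _ 1 1 m) scaler0 addr0.
  rewrite scale_scalar_mx -raddfD/=; rewrite [e * _]mulrC divfK ?gt_eqF//.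
  by rewrite addrC subrK.
rewrite (@volume_consE _ m).
pose h x := ((\1_(`[0%R, s]%classic : set R) x)%:E * a%:E +
   (\1_(`[(- e)%R, 0%R[%classic : set R) x)%:E * (s ^+ m)%:E +
   (\1_(`]s, (s + e)%R]%classic : set R) x)%:E * (s ^+ m)%:E)%E.
have mI (A : set R) r : measurable A -> measurable_fun setT (fun x : R => (\1_A x)%:E * r%:E)%E.
  by move=> mA; apply: emeasurable_funM => //; exact/measurable_EFinP/measurable_indic.
have I0 (A : set R) r (x : R) : 0 <= r -> (0 <= (\1_A x)%:E * r%:E)%E.
  by move=> r0; rewrite mule_ge0 ?lee_fin.
have -> : (s ^+ m.+1 + m.+1%:R * s ^+ m.+1.-1 * (2 * e))%:E = (\int[mu]_x h x)%E.
  rewrite ge0_integralD//; last 4 first.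
  - by move=> x _; rewrite adde_ge0// I0.
  - by apply: emeasurable_funD; apply: mI; exact: measurable_itv.
  - by move=> x _; exact: I0.
  - by apply: mI; exact: measurable_itv.
  rewrite ge0_integralD//; last 4 first.
  - by move=> x _; exact: I0.
  - by apply: mI; exact: measurable_itv.
  - by move=> x _; exact: I0.
  - by apply: mI; exact: measurable_itv.
  rewrite !integral_indicZ//; try exact: measurable_itv.
  rewrite !lebesgue_measure_itv/= !lte_fin s0 oppr_lt0 e0 ltrDl e0.
  rewrite -!EFinB -!EFinM -!EFinD; congr EFin.
  rewrite /a; case: (m) => [|k] /=; first by rewrite !expr0 expr1; ring.
  by rewrite -natr1 !exprS; ring.
apply: ge0_le_integral => //.
- by move=> x _; rewrite !adde_ge0// I0.
- by apply: emeasurable_funD; [apply: emeasurable_funD|]; apply: mI; exact: measurable_itv.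
- exact: (@measurable_volume_section _ m (P m.+1)).
move=> x _; rewrite -/(sec x) /h !indicE.
have mem (i : interval R) : (x \in [set` i]) = (x \in i).
  by apply/idP/idP => [/set_mem|xi]; [|exact/mem_set].
rewrite !mem !in_itv/=.
have [x0|x0] := ltP x 0; have [xs|xs] := leP x s.
- rewrite !(mul0e, add0e) ?andbT ?adde0; case: (leP (- e) x) => xe; rewrite ?mul1e ?mul0e ?adde0 ?volume_ge0//.
  by apply: (@sec_side x 0); rewrite ?lexx ?(ltW s0)// subr0 ltr0_norm// lerNl.
- by move: (lt_trans x0 s0); rewrite ltNge (ltW xs).
- by rewrite !andbF !mul0e !adde0 mul1e; apply: sec_mid; rewrite x0.
- rewrite !andbF !(mul0e, add0e)/=; case: (leP x (s + e)) => xe; rewrite ?mul1e ?mul0e ?volume_ge0//.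
  apply: (@sec_side x s); rewrite ?lexx ?(ltW s0)// gtr0_norm ?subr_gt0//.
  by rewrite lerBlDl.
Qed.

Lemma euclidean_unit_ball_orthogonal n (U : 'M[R]_n) (u : 'rV[R]_n) : U *m U^T = 1%:M ->
  euclidean_unit_ball (u *m U) <-> euclidean_unit_ball u.
Proof.
move=> UU; rewrite !unit_ballP -!mul_tr_self trmx_mul mulmxA -[u *m U *m _]mulmxA UU.
by rewrite mulmx1.
Qed.

(** An isometry carries Q to an axis-parallel box and preserves the Euclidean ball, hence parallel
    bodies. The box of side s + 2 e bounds the volume from above and agrees to first order with
    [volume_parallel_cube_ge]. *)
Lemma cube_volume_surface n (Q : set 'rV[R]_n) : (0 < n)%N -> cube Q ->
  exists2 s, 0 < s & volume Q = (s ^+ n)%:E /\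
    surface_area Q = (n%:R * s ^+ n.-1 * 2)%:E.
Proof.
move=> n0 [c [s s0 [U UU ->]]]; exists s => //.
have UU' : U^T *m U = 1%:M by exact: mulmx1C.
have uUT : U^T \in unitmx by have [] := mulmx1_unit UU'.
have detU : `|\det U^T| = 1.
  have := congr1 determinant UU'; rewrite det_mulmx det_tr det1 => /(congr1 Num.norm).
  rewrite normrM normr1 -expr2 => /eqP; rewrite -[X in _ == X](expr1n _ 2).
  by rewrite eqrXn2// => /eqP.
pose B := box (0 : 'rV[R]_n) (const_mx s).
set Q' := [set _ | _ in _].
have rot (X : set 'rV[R]_n) : vmeasurable X ->
    volume [set x | X (x *m U^T + - (c *m U^T))] = volume X.
  by move=> mX; rewrite volume_affine// detU invr1 mul1e.
have QE : Q' = [set x | B (x *m U^T + - (c *m U^T))].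
  apply/seteqP; split => x.
    move=> [t ht <-] i; rewrite mulmxDl addrAC subrr add0r -scalemxAl -mulmxA UU mulmx1.
    have /andP[t0 t1] := ht i; rewrite !mxE mulr_ge0 ?(ltW s0)//=.
    by rewrite ler_piMr// ltW.
  move=> Bx; exists (s^-1 *: (x *m U^T - c *m U^T)).
    move=> i; have := Bx i; rewrite !mxE => /andP[h0 h1].
    by rewrite mulr_ge0 ?invr_ge0 ?(ltW s0)//= ler_pdivrMl// mulr1.
  rewrite -scalemxAl scalerA divff ?gt_eqF// scale1r -mulmxBl -mulmxA UU' mulmx1.
  by rewrite addrC subrK.
have PE e : parallel_body Q' e = [set x | parallel_body B e (x *m U^T + - (c *m U^T))].
  rewrite QE; apply/seteqP; split => x.
    move=> [y By] [u Bu] <-; exists (y *m U^T + - (c *m U^T)) => //.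
    exists (u *m U^T); first by apply/euclidean_unit_ball_orthogonal; rewrite ?trmxK.
    by rewrite mulmxDl -scalemxAl addrAC.
  move=> [y By] [u Bu] E; exists (y *m U + c).
    by rewrite /= mulmxDl -mulmxA UU mulmx1 addrK.
  exists (u *m U); first exact/(euclidean_unit_ball_orthogonal u UU).
  rewrite scalemxAl addrAC -mulmxDl E mulmxDl -mulmxA UU' mulmx1.
  by rewrite mulNmx -mulmxA UU' mulmx1 subrK.
have mB : vmeasurable B by exact: vmeasurable_box.
have mP e : vmeasurable (parallel_body B e).
  by apply: vmeasurable_compact; apply: compact_parallel_body; exact: compact_box.
have vB : volume B = (s ^+ n)%:E.
  rewrite volume_box => [|i]; last by rewrite !mxE ltW.
  rewrite (eq_bigr (fun=> s)) => [|i _]; last by rewrite !mxE subr0.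
  by rewrite prodr_const card_ord.
have vQ : volume Q' = (s ^+ n)%:E by rewrite QE rot.
split => //.
apply: (@surface_area_eq _ _ _ _ (4 ^+ n * s ^+ n * (2 / s) ^+ 2)).
near=> e.
have e0 : 0 < e by near: e; exact: nbhs_right_gt.
have es : 2 * e / s <= 1.
  rewrite ler_pdivrMr// mul1r -ler_pdivlMl//; near: e; apply: nbhs_right_le.
  by rewrite mulr_gt0.
apply/andP; split.
  apply: (growth_ge e0 vQ); rewrite PE rot//.
  by have := volume_parallel_cube_ge n s0 e0; rewrite [_ * (2 * e)]mulrA.
apply: (growth_le e0 vQ); rewrite PE rot//.
have sub : parallel_body B e `<=` box (const_mx (- e)) (const_mx (s + e)).
  move=> _ [y By] [u /unit_ball_coord Bu] <- i; have := By i; have := Bu i.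
  rewrite !mxE ler_norml => /andP[u1 u2] /andP[y1 y2].
  by apply/andP; split; nra.
apply: le_trans (le_volume (mP e) (vmeasurable_box _ _) sub) _.
rewrite volume_box => [|i]; last by rewrite !mxE; lra.
rewrite lee_fin (eq_bigr (fun=> s * (1 + 2 * e / s))) => [|i _]; last first.
  by rewrite !mxE; field; rewrite gt_eqF.
rewrite prodr_const card_ord exprMn.
apply: le_trans (_ : s ^+ n * (1 + n%:R * (2 * e / s) + 4 ^+ n * (2 * e / s) ^+ 2) <= _).
  rewrite ler_wpM2l ?exprn_ge0 ?(ltW s0)// expr_quadratic_le// es andbT.
  by rewrite divr_ge0 ?mulr_ge0// ltW.
rewrite -(prednK n0) exprS prednK// le_eqVlt; apply/orP; left; apply/eqP.
by field; rewrite gt_eqF.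
Unshelve. all: by end_near.
Qed.

End Cube.

Lemma nth_rootP {R : realType} (v : R) n : (0 < n)%N -> 0 < v ->
  exists2 w, 0 < w & w ^+ n = v.
Proof.
move=> n0 v0; exists (v `^ n%:R^-1); first exact: powR_gt0.
rewrite -powR_mulrn ?powR_ge0// -powRrM mulVf ?powRr1 ?(ltW v0)//.
by rewrite pnatr_eq0 -lt0n.
Qed.

Lemma volume_scale {R : realType} n (r : R) (X : set 'rV[R]_n) : 0 < r -> vmeasurable X ->
  volume [set y | X (r^-1 *: y)] = ((r ^+ n)%:E * volume X)%E.
Proof.
move=> r0 mX; have ur : (r^-1)%:M \in (@unitmx R n).
  by rewrite unitmxE det_scalar unitfE expf_neq0// invr_neq0// gt_eqF.
transitivity (volume [set y | X (y *m (r^-1)%:M + 0)]).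
  by congr volume; apply: eq_set => y; rewrite mul_mx_scalar addr0.
by rewrite volume_affine// det_scalar exprVn normrV ?unitfE ?expf_neq0 ?gt_eqF// invrK gtr0_norm ?exprn_gt0.
Qed.

Lemma vmeasurable_scale {R : realType} n (r : R) (X : set 'rV[R]_n) : vmeasurable X ->
  vmeasurable [set y | X (r *: y)].
Proof.
move=> /(vmeasurable_affine r%:M 0).
by under eq_set do rewrite mul_mx_scalar addr0.
Qed.

Lemma continuous_rV {R : realType} (T : topologicalType) n (f : T -> 'rV[R]_n) :
  (forall k, continuous (fun x => f x 0 k)) -> continuous f.
Proof.
move=> cf x A [P xP PA].
have : \forall y \near x, forall k, P 0 k (f y 0 k).
  by apply: filter_forall => k; exact: cf (xP 0 k).
by apply: filterS => y Py; apply: PA => i k; rewrite (ord1 i).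
Qed.

Lemma compact_mulmx {R : realType} m n (N : 'M[R]_(m, n)) (X : set 'rV[R]_m) :
  compact X -> compact [set x *m N | x in X].
Proof.
move=> cX; apply: continuous_compact => //.
apply: continuous_subspaceT; apply: continuous_rV => k.
have -> : (fun x : 'rV[R]_m => (x *m N) 0 k) = (fun x => \sum_j N j k * x 0 j).
  by apply/funext => x; rewrite mxE; apply: eq_bigr => j _; rewrite mulrC.
apply: continuous_sum => j; apply: continuous_mull; exact: coord_continuous.
Qed.

(** * From the inscribed ball to the surface area *)

Section FromBallPosition.
Context {R : realType} {n : nat}.
Hypothesis n_gt0 : (0 < n)%N.
Variable D : set 'rV[R]_n.
Hypotheses (cD : compact D) (D_ball : forall y : 'rV[R]_n, \sum_k y 0 k ^+ 2 <= 1 -> D y).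
Hypothesis D_vol : (volume D <= (2 ^+ n)%:E)%E.
Hypothesis D_conv : forall x y t, 0 <= t <= 1 -> D x -> D y -> D (t *: x + (1 - t) *: y).

Let mD : vmeasurable D := vmeasurable_compact cD.

Lemma volume_root : exists2 w, 0 < w <= 2 & volume D = (w ^+ n)%:E.
Proof.
have n0 : 0 < n%:R :> R by rewrite ltr0n.
have n1 : 1 <= n%:R :> R by rewrite ler1n.
have vfin : volume D \is a fin_num.
  by rewrite ge0_fin_numE ?volume_ge0// (le_lt_trans D_vol)// ltry.
(* This small cube inside the unit ball shows that the volume of D is positive. *)
have sub : box (0 : 'rV[R]_n) (const_mx n%:R^-1) `<=` D.
  move=> y By; apply: D_ball.
  apply: le_trans (_ : \sum_(k < n) n%:R^-1 <= _); last first.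
    by rewrite sumr_const card_ord -[leLHS]mulr_natr mulVf// gt_eqF.
  apply: ler_sum => k _; have := By k; rewrite !mxE => /andP[y0 y1].
  have i1 : n%:R^-1 <= 1 :> R by rewrite invf_le1.
  by rewrite expr2; nra.
have : 0 < fine (volume D).
  rewrite -lte_fin fineK//; apply: lt_le_trans (le_volume (vmeasurable_box _ _) mD sub).
  rewrite volume_box => [|i]; last by rewrite !mxE invr_ge0 ltW.
  by rewrite lte_fin; apply: prodr_gt0 => i _; rewrite !mxE subr0 invr_gt0.
move=> /(nth_rootP n_gt0)[w w0 wE]; exists w; last by rewrite wE fineK.
rewrite w0/= -(ler_pXn2r n_gt0) ?nnegrE ?(ltW w0)//.
by rewrite wE -lee_fin fineK.
Qed.

Lemma scaled_surface_area_le s : 0 < s -> exists2 l, 0 < l &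
  let D' := [set y | D (l^-1 *: y)] in
  volume D' = (s ^+ n)%:E /\ (surface_area D' <= (n%:R * s ^+ n.-1 * 2)%:E)%E.
Proof.
move=> s0; have [w /andP[w0 w2] vD] := volume_root.
pose l := s / w; have l0 : 0 < l by exact: divr_gt0.
exists l => //; set D' := [set y | _].
have vD' : volume D' = (s ^+ n)%:E.
  by rewrite volume_scale// vD -EFinM -exprMn divfK// gt_eqF.
split => //.
have mD' : vmeasurable D' by exact: vmeasurable_scale.
apply: (@le_trans _ _ (n%:R * s ^+ n / l)%:E); last first.
  rewrite lee_fin /l -(prednK n_gt0) exprS prednK// invf_div.
  have -> : n%:R * (s * s ^+ n.-1) * (w / s) = n%:R * s ^+ n.-1 * w.
    by field; rewrite gt_eqF.
  by rewrite ler_wpM2l// mulr_ge0// exprn_ge0// ltW.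
apply: (@surface_area_le _ _ _ _ (4 ^+ n * s ^+ n / l ^+ 2)).
  apply: divr_ge0 (ltW l0); apply: mulr_ge0 => //.
  by rewrite exprn_ge0// ltW.
near=> e.
have e0 : 0 < e by near: e; exact: nbhs_right_gt.
have el : e / l <= 1.
  by rewrite ler_pdivrMr// mul1r; near: e; exact: nbhs_right_le.
have t0 : 0 < 1 + e / l by rewrite ltr_pwDl// divr_ge0// ltW.
apply: (growth_le e0 vD').
(* Divided by l + e, the point y + e u becomes a convex combination of [l^-1 *: y] and u, both in
   D. *)
have sub : parallel_body D' e `<=` [set y | D' ((1 + e / l)^-1 *: y)].
  move=> _ [y Dy] [u /unit_ballP /D_ball Du] <- /=; rewrite /D' /=.
  have -> : l^-1 *: ((1 + e / l)^-1 *: (y + e *: u)) =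
      (1 + e / l)^-1 *: (l^-1 *: y) + (1 - (1 + e / l)^-1) *: u.
    apply/rowP => k; rewrite !mxE; field.
    by rewrite !gt_eqF//= addr_gt0.
  apply: D_conv => //; rewrite invr_ge0 (ltW t0)/= invf_le1// lerDl.
  by rewrite divr_ge0// ltW.
have mP : vmeasurable (parallel_body D' e).
  apply: vmeasurable_compact; apply: compact_parallel_body.
  have -> : D' = [set x *m l%:M | x in D].
    apply/seteqP; split => y.
      move=> Dy; exists (l^-1 *: y) => //.
      by rewrite mul_mx_scalar scalerA divff ?gt_eqF// scale1r.
    move=> [x Dx <-]; rewrite /D' /= mul_mx_scalar scalerA mulVf ?gt_eqF//.
    by rewrite scale1r.
  exact: compact_mulmx.
apply: le_trans (le_volume mP (vmeasurable_scale _ mD') sub) _.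
rewrite volume_scale// vD' -EFinM lee_fin.
apply: le_trans (_ : (1 + n%:R * (e / l) + 4 ^+ n * (e / l) ^+ 2) * s ^+ n <= _).
  rewrite ler_wpM2r ?exprn_ge0 ?(ltW s0)// expr_quadratic_le// el andbT.
  by rewrite divr_ge0// ltW.
rewrite le_eqVlt; apply/orP; left; apply/eqP.
by field; rewrite gt_eqF.
Unshelve. all: by end_near.
Qed.

End FromBallPosition.

Theorem theorem2 (R : realType) (n : nat) (n_ge1 : (1 <= n)%N)
    (C : set 'rV[R]_n) (C_body : convex_body C) (C_sym : symmetric_body C)
    (Q : set 'rV[R]_n) (Q_cube : cube Q) :
  exists C' : set 'rV[R]_n,
    [/\ affine_image C C',
        volume C' = volume Q &
        (surface_area C' <= surface_area Q)%E].
Proof.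
have [s s0 [-> ->]] := cube_volume_surface n_ge1 Q_cube.
have [N uN [ball vol]] := ball_position n_ge1 C_body C_sym.
set D := [set _ | _ in _] in ball vol.
have cD : compact D by apply: compact_mulmx; case: C_body.
have D_conv x y t : 0 <= t <= 1 -> D x -> D y -> D (t *: x + (1 - t) *: y).
  move=> t01 [x' Cx <-] [y' Cy <-]; exists (t *: x' + (1 - t) *: y').
    exact: (body_conv C_body).
  by rewrite mulmxDl !scalemxAl.
have [l l0 [vD' sD']] := scaled_surface_area_le n_ge1 cD ball vol D_conv s0.
exists [set y | D (l^-1 *: y)]; split => //.
exists (l *: N).
  by rewrite unitmxE detZ unitrMl -?unitmxE// unitfE expf_neq0// gt_eqF.
exists 0; apply/seteqP; split => y.
  move=> [x Cx E]; exists x => //.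
  by rewrite addr0 -scalemxAr E scalerA divff ?gt_eqF// scale1r.
by move=> [x Cx <-]; exists x => //; rewrite addr0 -scalemxAr scalerA mulVf ?gt_eqF// scale1r.
Qed.
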